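(* Let $A$ be a gentle algebra with one maximal path, let $\alpha\in\mathfrak S_n$ be the quasi-diagram associated to $A$, and let $\zeta=(1\,2\,3\cdots n)\in\mathfrak S_n$. Then the following are equivalent. (1) The global dimension of $A$ is finite: $\operatorname{gldim}A<\infty$. (2) Every orbit of $\zeta\alpha$ on $\{1,\dots,n\}$ contains either $1$ or at least one isolated point of $\alpha$. (3) Every orbit of $\alpha\zeta$ on $\{1,\dots,n\}$ contains either $n$ or at least one isolated point of $\alpha$.
   Context: $k$ is an algebraically closed field of characteristic $0$; all algebras are over $k$ and basic. In a quiver $Q$, an arrow $a$ has source $s(a)$ and target $t(a)$; a path $a_1a_2\cdots a_l$ is composed from left to right, i.e. $t(a_i)=s(a_{i+1})$. An algebra $A$ is locally gentle if $A\cong kQ/I$ where: (1) $Q$ is a finite quiver such that at each vertex at most two arrows end and at most two arrows start; (2) $I$ is generated by paths of length two; (3) for every arrow $a$ there is at most one arrow $b$ such that $ab$ is a path in $I$ and at most one arrow $c$ such that $ca$ is a path in $I$, and there is at most one arrow $b'$ such that $ab'$ is a path not in $I$ and at most one arrow $c'$ such that $c'a$ is a path not in $I$. A gentle algebra is a finite-dimensional locally gentle algebra. A (nonzero) path in $A=kQ/I$ is a path $p$ of $Q$ (possibly trivial) with $p\notin I$; it is maximal if $pa=ap=0$ in $A$ for every arrow $a$. In a gentle algebra every arrow lies in a unique maximal path. ''Gentle algebra with one maximal path'' means that $A$ has exactly one maximal path $p$. If $p$ has length $n-1$ and passes successively through the vertices $v_1,\dots,v_n$ of $Q$ (each vertex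 of $Q$ occurs at most twice in this list), the associated permutation $\alpha\in\mathfrak S_n$ is given by $\alpha(i)=j$ if there is $j\ne i$ with $v_j=v_i$, and $\alpha(i)=i$ otherwise. Equivalently, $A$ is the subalgebra of the path algebra of the linear quiver $1\to2\to\cdots\to n$ spanned by its radical and the elements $e_i+e_{\alpha(i)}$ ($\alpha(i)\neq i$) and $e_i$ ($\alpha(i)=i$), where $e_i$ is the idempotent at vertex $i$. A quasi-diagram is a permutation $\alpha\in\mathfrak S_n$ with $\alpha^2=\mathrm{id}$. An isolated point of $\alpha$ is a point $i$ with $\alpha(i)=i$. Permutations are composed from right to left. *)

(* Defs.v *)
From HB Require Import structures.
From mathcomp Require Import all_boot all_order all_algebra all_fingroup all_field.
From mathcomp Require Import finmap.
From mathcomp.multinomials Require Import monalg.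

Set Implicit Arguments.
Unset Strict Implicit.
Unset Printing Implicit Defensive.

Import GRing.Theory.
Local Open Scope ring_scope.

Record quiver := Quiver {
  vertex : finType;
  arrow : finType;
  source : arrow -> vertex;
  target : arrow -> vertex
}.

Section Paths.
Variable Q : quiver.

Fixpoint walk (v : vertex Q) (s : seq (arrow Q)) : bool :=
  if s is a :: s' then (source a == v) && walk (target a) s' else true.

(* A path is its starting vertex together with its arrows, listed from left
   to right; the trivial path at v is (v, [::]). *)
Record qpath := QPath {
  qpath_val : vertex Q * seq (arrow Q);
  _ : walk qpath_val.1 qpath_val.2
}.
HB.instance Definition _ := [isSub for qpath_val].
HB.instance Definition _ := [Choice of qpath by <:].

Definition pstart (p : qpath) := (val p).1.
Definition parrows (p : qpath) := (val p).2.
Definition plength (p : qpath) := size (parrows p).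
Definition pverts (p : qpath) := pstart p :: map (@target Q) (parrows p).
Definition pend (p : qpath) := last (pstart p) (map (@target Q) (parrows p)).

(* The vertices v_0, ..., v_l successively visited by a path of length l. *)
Definition pvert (p : qpath) (i : 'I_(plength p).+1) : vertex Q :=
  nth (pstart p) (pverts p) i.

Definition ptriv (v : vertex Q) : qpath := @QPath (v, [::]) isT.

Lemma parr_subproof (a : arrow Q) : walk (source a) [:: a].
Proof. by rewrite /= eqxx. Qed.
Definition parr (a : arrow Q) : qpath := QPath (@parr_subproof a : walk (_, _).1 (_, _).2).

(* None when p and q are not composable *)
Definition pcomp (p q : qpath) : option qpath :=
  if pend p == pstart q then insub (pstart p, parrows p ++ parrows q) else None.

Lemma walk_cat v s1 s2 :
  walk v (s1 ++ s2) = walk v s1 && walk (last v (map (@target Q) s1)) s2.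
Proof. by elim: s1 v => //= a s IHs v; rewrite IHs andbA. Qed.

Lemma pcompP p q (e : pend p = pstart q) :
  exists2 r, pcomp p q = Some r &
    val r = (pstart p, parrows p ++ parrows q).
Proof.
rewrite /pcomp e eqxx; case: insubP => [r _ er | /=]; first by exists r.
by rewrite walk_cat -/(pend p) e (valP p : walk _ _) (valP q : walk _ _).
Qed.

Lemma pcompN p q : pend p != pstart q -> pcomp p q = None.
Proof. by rewrite /pcomp => /negPf->. Qed.

Lemma pcomp_ends p q r : pcomp p q = Some r ->
  pstart r = pstart p /\ pend r = pend q.
Proof.
have [e|ne] := eqVneq (pend p) (pstart q); last by rewrite /pcomp (negPf ne).
have [r' -> er'] := pcompP e; case=> <-.
rewrite /pend /pstart /parrows er' /=; split=> //.
by rewrite map_cat last_cat -/(pend p) e.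
Qed.

Lemma pcompA p q r :
  obind (fun u => pcomp u r) (pcomp p q) = obind (pcomp p) (pcomp q r).
Proof.
have [e1|n1] := eqVneq (pend p) (pstart q); last first.
  rewrite (pcompN n1) /=; case E: (pcomp q r) => [w|] //=.
  by have [Ew _] := pcomp_ends E; rewrite pcompN // Ew.
have [u E1 eu] := pcompP e1; have [su tu] := pcomp_ends E1; rewrite E1 /=.
have [e2|n2] := eqVneq (pend q) (pstart r); last first.
  by rewrite (pcompN n2) pcompN // tu.
have [w E2 ew] := pcompP e2; have [sw _] := pcomp_ends E2; rewrite E2 /=.
have [x -> ex] := pcompP (etrans tu e2).
have [y -> ey] := pcompP (etrans e1 (esym sw)).
congr Some; apply: val_inj; rewrite ex ey su.
by rewrite /parrows eu ew /= catA.
Qed.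

Lemma pcomp_trivl v p :
  pcomp (ptriv v) p = if v == pstart p then Some p else None.
Proof.
have [->|n] := eqVneq v (pstart p); last by rewrite /pcomp (negPf n).
have [r -> er] := @pcompP (ptriv (pstart p)) p erefl.
by congr Some; apply: val_inj; rewrite er [RHS]surjective_pairing.
Qed.

Lemma pcomp_trivr v p :
  pcomp p (ptriv v) = if v == pend p then Some p else None.
Proof.
have [->|n] := eqVneq v (pend p); last by rewrite /pcomp eq_sym (negPf n).
have [r -> er] := @pcompP p (ptriv (pend p)) erefl.
by congr Some; apply: val_inj; rewrite er /= cats0 [RHS]surjective_pairing.
Qed.

End Paths.

(* kQ is unital because Q has finitely many vertices; it is only declared a
   pzRingType since it is the zero ring when Q is empty. *)
Definition pathalg (k : nzRingType) (Q : quiver) := {malg k[qpath Q]}.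

HB.instance Definition _ (k : nzRingType) (Q : quiver) :=
  GRing.Lmodule.on (pathalg k Q).

(* The path p as an element of kQ.  This definition and pamul are locked
   because unification is very slow on unfolded finitely supported functions. *)
HB.lock Definition pbasis (k : nzRingType) (Q : quiver) (p : qpath Q) :
  pathalg k Q := mkmalgU p 1.

Definition pbmul (k : nzRingType) (Q : quiver) (p q : qpath Q) : pathalg k Q :=
  oapp (@pbasis k Q) 0 (pcomp p q).

HB.lock Definition pamul (k : nzRingType) (Q : quiver) (x y : pathalg k Q) :
  pathalg k Q :=
  \sum_(p <- msupp x) \sum_(q <- msupp y) (x@_p * y@_q) *: pbmul k p q.

Section PathAlgebra.
Variables (k : comNzRingType) (Q : quiver).
Local Notation kQ := (pathalg k Q).
Local Notation pbasis := (@pbasis k Q).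
Local Notation pbmul := (@pbmul k Q).
Local Notation pamul := (@pamul k Q).

Lemma mcoeff_pbasis (p q : qpath Q) : (pbasis p)@_q = (p == q)%:R.
Proof. by rewrite pbasis.unlock mcoeffU. Qed.

Definition paone : kQ := \sum_(v : vertex Q) pbasis (ptriv v).

Lemma pamulEw (d1 d2 : {fset qpath Q}) (x y : kQ) :
  (msupp x `<=` d1)%fset -> (msupp y `<=` d2)%fset ->
  pamul x y = \sum_(p <- d1) \sum_(q <- d2) (x@_p * y@_q) *: pbmul p q.
Proof.
move=> le1 le2; rewrite pamul.unlock (big_fset_incl _ le1) /=.
  apply/eq_bigr=> p _; apply/big_fset_incl => // q _ /mcoeff_outdom ->.
  by rewrite mulr0 scale0r.
move=> p _ /mcoeff_outdom xp.
by rewrite big1 => // q _; rewrite xp mul0r scale0r.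
Qed.

Lemma pamulDl : left_distributive pamul +%R.
Proof.
move=> x y z.
rewrite [in RHS](pamulEw (fsubsetUl _ (msupp y)) (fsubset_refl _)).
rewrite [in RHS](pamulEw (fsubsetUr (msupp x) _) (fsubset_refl _)).
rewrite (pamulEw (msuppD_le _ _) (fsubset_refl _)).
rewrite -big_split /=; apply/eq_bigr=> p _.
rewrite -big_split /=; apply/eq_bigr=> q _.
by rewrite mcoeffD mulrDl scalerDl.
Qed.

Lemma pamulDr : right_distributive pamul +%R.
Proof.
move=> z x y.
rewrite [in RHS](pamulEw (fsubset_refl _) (fsubsetUl _ (msupp y))).
rewrite [in RHS](pamulEw (fsubset_refl _) (fsubsetUr (msupp x) _)).
rewrite (pamulEw (fsubset_refl _) (msuppD_le _ _)).
rewrite -big_split /=; apply/eq_bigr=> p _.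
rewrite -big_split /=; apply/eq_bigr=> q _.
by rewrite mcoeffD mulrDr scalerDl.
Qed.

Lemma pamul0l : left_zero 0 pamul.
Proof. by move=> x; rewrite pamul.unlock msupp0 big_seq_fset0. Qed.

Lemma pamul0r : right_zero 0 pamul.
Proof.
move=> x; rewrite pamul.unlock; apply: big1 => p _; by rewrite msupp0 big_seq_fset0.
Qed.

Lemma pamulZl c x y : pamul (c *: x) y = c *: pamul x y.
Proof.
rewrite (pamulEw (msuppZ_le _ _) (fsubset_refl _)) pamul.unlock scaler_sumr.
apply/eq_bigr=> p _; rewrite scaler_sumr; apply/eq_bigr=> q _.
by rewrite mcoeffZ scalerA mulrA.
Qed.

Lemma pamulZr c x y : pamul x (c *: y) = c *: pamul x y.
Proof.
rewrite (pamulEw (fsubset_refl _) (msuppZ_le _ _)) pamul.unlock scaler_sumr.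
apply/eq_bigr=> p _; rewrite scaler_sumr; apply/eq_bigr=> q _.
by rewrite mcoeffZ scalerA mulrCA.
Qed.

Lemma pamul_suml (I : Type) (r : seq I) (P : pred I) (F : I -> kQ) y :
  pamul (\sum_(i <- r | P i) F i) y = \sum_(i <- r | P i) pamul (F i) y.
Proof. by apply: (big_morph (pamul^~ y) (fun _ _ => pamulDl _ _ _) (pamul0l _)). Qed.

Lemma pamul_sumr (I : Type) (r : seq I) (P : pred I) (F : I -> kQ) y :
  pamul y (\sum_(i <- r | P i) F i) = \sum_(i <- r | P i) pamul y (F i).
Proof. by apply: (big_morph (pamul y) (fun _ _ => pamulDr _ _ _) (pamul0r _)). Qed.

Lemma pbasis_expand (x : kQ) : x = \sum_(p <- msupp x) x@_p *: pbasis p.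
Proof.
rewrite [LHS]monalgE; apply/eq_bigr=> p _; apply/malgP => q.
apply: etrans (mcoeffU _ _ _) (esym _); apply: etrans (mcoeffZ _ _ _) _.
by rewrite mcoeff_pbasis mulr_natr.
Qed.

Lemma pbasis_ext (f g : kQ -> kQ) : linear f -> linear g ->
  (forall p, f (pbasis p) = g (pbasis p)) -> f =1 g.
Proof.
move=> lf lg fg x.
have f0 : f 0 = 0 by have := lf (-1) 0 0; rewrite !scaleN1r oppr0 addr0 addNr.
have g0 : g 0 = 0 by have := lg (-1) 0 0; rewrite !scaleN1r oppr0 addr0 addNr.
rewrite (pbasis_expand x); elim: (enum_fset (msupp x)) => [|p s IHs].
  by rewrite !big_nil f0 g0.
by rewrite !big_cons lf lg fg IHs.
Qed.

Lemma pamul_linl y : linear (pamul^~ y).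
Proof. by move=> c u v /=; rewrite pamulDl pamulZl. Qed.

Lemma pamul_linr x : linear (pamul x).
Proof. by move=> c u v /=; rewrite pamulDr pamulZr. Qed.

Lemma pamul_basis p q : pamul (pbasis p) (pbasis q) = pbmul p q.
Proof.
have msb r : msupp (pbasis r) = [fset r]%fset.
  by rewrite pbasis.unlock msuppU oner_eq0.
rewrite pamul.unlock !msb !big_seq_fset1.
by rewrite !mcoeff_pbasis !eqxx mulr1 scale1r.
Qed.

Lemma pamulA : associative pamul.
Proof.
move=> x y z; move: x; apply: pbasis_ext => [c u v|c u v|p].
- exact: pamul_linl.
- by rewrite !pamul_linl.
move: y; apply: pbasis_ext => [c u v|c u v|q].
- by rewrite pamul_linl pamul_linr.
- by rewrite pamul_linr pamul_linl.
move: z; apply: pbasis_ext => [c u v|c u v|r].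
- by rewrite !pamul_linr.
- exact: pamul_linr.
rewrite !pamul_basis; have := pcompA p q r; rewrite /Defs.pbmul.
case: (pcomp p q) => [u|]; case: (pcomp q r) => [w|] //= E.
- by rewrite !pamul_basis /Defs.pbmul E.
- by rewrite pamul_basis /Defs.pbmul E pamul0r.
- by rewrite pamul_basis /Defs.pbmul -E pamul0l.
- by rewrite pamul0l pamul0r.
Qed.

Lemma pamul1l : left_id paone pamul.
Proof.
apply: pbasis_ext => [|c u v|p] //; first exact: pamul_linr.
rewrite pamul_suml (bigD1 (pstart p)) //= big1 => [|v n].
  by rewrite addr0 pamul_basis /Defs.pbmul pcomp_trivl eqxx.
by rewrite pamul_basis /Defs.pbmul pcomp_trivl (negPf n).
Qed.

Lemma pamul1r : right_id paone pamul.
Proof.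
apply: (@pbasis_ext (pamul^~ paone)) => [|c u v|p] //.
  exact: pamul_linl.
rewrite pamul_sumr (bigD1 (pend p)) //= big1 => [|v n].
  by rewrite addr0 pamul_basis /Defs.pbmul pcomp_trivr eqxx.
by rewrite pamul_basis /Defs.pbmul pcomp_trivr (negPf n).
Qed.

HB.instance Definition _ := GRing.Zmodule_isPzRing.Build kQ
  pamulA pamul1l pamul1r pamulDl pamulDr.

Lemma pbasisM p q : pbasis p * pbasis q = pbmul p q.
Proof. exact: pamul_basis. Qed.

Lemma pathalg1E : 1 = \sum_(v : vertex Q) pbasis (ptriv v).
Proof. by []. Qed.

End PathAlgebra.

Definition two_sided_ideal (R : pzRingType) (J : R -> Prop) : Prop :=
  [/\ J 0, (forall x y, J x -> J y -> J (x + y)) &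
      forall a x, J x -> J (a * x) /\ J (x * a)].

Definition ideal_generated_by (R : pzRingType) (S : R -> Prop) (x : R) : Prop :=
  forall J : R -> Prop, two_sided_ideal J -> (forall s, S s -> J s) -> J x.

Definition at_most_one (T : Type) (P : T -> Prop) : Prop :=
  forall x y, P x -> P y -> x = y.

Section Gentle.
Variables (k : comNzRingType) (Q : quiver) (I : pathalg k Q -> Prop).
Local Notation arr a := (pbasis k (parr a)).

Definition quadratic_monomial_ideal : Prop :=
  exists R : qpath Q -> Prop,
    (forall r, R r -> plength r = 2%N) /\
    (forall x, I x <-> ideal_generated_by (fun y => exists2 r, R r & y = pbasis k r) x).

(* For non-composable a, b the product is 0, which lies in I, hence the
   composability clauses. *)
Definition path_in (a b : arrow Q) : Prop :=
  target a = source b /\ I (arr a * arr b).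
Definition path_notin (a b : arrow Q) : Prop :=
  target a = source b /\ ~ I (arr a * arr b).

Definition locally_gentle : Prop :=
  [/\ forall v : vertex Q,
        (#|[pred a : arrow Q | target a == v]| <= 2)%N /\
        (#|[pred a : arrow Q | source a == v]| <= 2)%N,
      quadratic_monomial_ideal &
      forall a : arrow Q,
        [/\ at_most_one (fun b => path_in a b),
            at_most_one (fun c => path_in c a),
            at_most_one (fun b => path_notin a b) &
            at_most_one (fun c => path_notin c a)]].

Definition maximal_path (p : qpath Q) : Prop :=
  ~ I (pbasis k p) /\
  forall a : arrow Q, I (pbasis k p * arr a) /\ I (arr a * pbasis k p).

(* A is isomorphic to kQ/I: there is a surjective k-algebra morphism kQ -> A
   with kernel I. *)
Definition iso_quotient (A : algType k) : Prop :=
  exists pi : {linear pathalg k Q -> A},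
    [/\ monoid_morphism pi, (forall y : A, exists x, pi x = y) &
        forall x, pi x = 0 <-> I x].

End Gentle.

(* With n = plength p + 1, the point i : 'I_n stands for i+1 in {1, ..., n}, so
   that 1 is ord0 and n is ord_max. *)
Definition associated_quasi_diagram (Q : quiver) (p : qpath Q)
    (alpha : 'S_(plength p).+1) : Prop :=
  forall i,
    (forall j, j <> i -> pvert j = pvert i -> alpha i = j) /\
    ((forall j, j <> i -> pvert j <> pvert i) -> alpha i = i).

Definition zeta (n : nat) : 'S_n := perm (@ordS_inj n).

(* Left modules; for a finite-dimensional algebra the left and right global
   dimensions agree. *)
Section GlobalDimension.
Variable R : pzRingType.

Definition projective_module (P : lmodType R) : Prop :=
  forall (M N : lmodType R) (g : {linear M -> N}) (h : {linear P -> N}),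
    (forall y, exists x, g x = y) ->
    exists h' : {linear P -> M}, forall x, g (h' x) = h x.

(* M has a projective resolution 0 -> P_d -> ... -> P_0 -> M -> 0 *)
Definition pdim_le (M : lmodType R) (d : nat) : Prop :=
  exists (P : nat -> lmodType R) (eps : {linear P 0%N -> M})
         (del : forall i, {linear P i.+1 -> P i}),
    [/\ forall i, projective_module (P i),
        forall y, exists x, eps x = y,
        forall x, eps x = 0 <-> exists y, del 0%N y = x,
        forall i x, del i x = 0 <-> exists y, del i.+1 y = x &
        forall i, (d < i)%N -> forall x : P i, x = 0].

Definition gldim_finite : Prop :=
  exists d : nat, forall M : lmodType R, pdim_le M d.

End GlobalDimension.

(* Submission.v *)
Require Import Defs.
From HB Require Import structures.
From mathcomp Require Import all_boot all_order all_algebra all_fingroup all_field.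
From mathcomp Require Import finmap.
From mathcomp.multinomials Require Import monalg.
From mathcomp Require boolp classical_sets.

Set Implicit Arguments.
Unset Strict Implicit.
Unset Printing Implicit Defensive.

Import GRing.Theory.
Local Open Scope ring_scope.

(** Let [n] be the number of vertices, with repetitions, that the maximal path
    [p] visits.  In a
    finite-dimensional algebra with a quadratic monomial ideal every nonzero path
    extends to a maximal one, hence is a segment of [p].  Reading off the
    coefficients along the segments of [p] identifies [A] with the algebra of
    upper triangular [n] x [n] matrices [X] with [X i i = X (alpha i) (alpha i)]
    ([coord_model]).  From there on only this matrix algebra is used.

    Write [a] also for the arrow from the point [a] to the point [a + 1].  The
    product of the arrows [a] and [b] vanishes although they are composable
    exactly when [b = alpha (a + 1)] and [b != a + 1].  With
    [sigma a = alpha (a + 1)], a chain, that is a sequence of arrows with all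
    consecutive products in the ideal, is therefore [a, sigma a, sigma^2 a, ...],
    and it can be continued until it reaches the last point or an isolated point.
    So all chains are bounded if and only if every orbit of [sigma], which is
    the permutation [alpha zeta] of the third condition, contains the last point
    or an isolated point.  Conjugation by [alpha] turns this into the condition
    on [zeta alpha] ([orbit_conditions_equiv]).

    The global dimension is the supremum of the lengths of the chains.  Every
    module [M] has a Koszul resolution, functorial in [M], whose term in degree
    [d] is the sum of the [A e (x) f M] over the chains of length [d] from the
    vertex of [e] to the vertex of [f] ([koszul_resolution]).  If chains are
    bounded, this resolution is finite.  The terms are projective because
    surjections of modules split over the field ([scalar_section]); as [M] is
    arbitrary this uses a complement of an infinite-dimensional subspace.
    Conversely, the resolution of the sum of all simple modules is minimal, its
    differentials taking values in the radical.  If that module had a resolution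
    of length [d], then by comparison ([resolution_contraction]) every element
    in degree [d + 1] would lie in the radical, which is impossible as long as
    there are chains of length [d + 1]. *)

(** * Scalars acting through the algebra *)

Lemma scaleAA (k : fieldType) (A : algType k) (M : lmodType A) (c d : k) (v : M) :
  c%:A *: (d%:A *: v) = (c * d)%:A *: v.
Proof. by rewrite scalerA -scalerAl mul1r scalerA. Qed.

Lemma scaleAC (k : fieldType) (A : algType k) (M : lmodType A) (c : k) (x : A) (v : M) :
  x *: (c%:A *: v) = c%:A *: (x *: v).
Proof. by rewrite !scalerA -scalerAl mul1r -scalerAr mulr1. Qed.

Lemma scale_scaleA (k : fieldType) (A : algType k) (M : lmodType A) (c : k) (x : A) (v : M) :
  (c *: x) *: v = c%:A *: (x *: v).
Proof. by rewrite scalerA -scalerAl mul1r. Qed.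

Lemma scale_boolA (k : fieldType) (A : algType k) (M : lmodType A) (b : bool) (v : M) :
  (b%:R : k)%:A *: v = if b then v else 0.
Proof. by case: b; rewrite ?scale1r // !scale0r. Qed.

(** * Sections of linear surjections *)

(** A maximal subspace meeting the kernel trivially (Zorn) is a complement of
    the kernel, and inverting [g] on it gives the section.  The base field acts
    on the modules through its image [c%:A] in [A], because only [A]-modules
    occur below. *)
Lemma scalar_section (k : fieldType) (A : algType k) (M N : lmodType A)
    (g : {linear M -> N}) :
  (forall y, exists x, g x = y) ->
  exists2 t : N -> M, cancel t g &
    forall (c : k) x y, t (c%:A *: x + y) = c%:A *: t x + t y.
Proof.
move=> gsurj.
pose P (G : classical_sets.set M) :=
  (forall (c : k) x y, G x -> G y -> G (c%:A *: x + y)) /\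
  (forall x, G x -> g x = 0 -> x = 0).
have scD (c d : k) (x : M) : c%:A *: x + d%:A *: x = (c + d)%:A *: x.
  by rewrite !scalerDl.
have sc1 (x : M) : 1%:A *: x = x by rewrite !scale1r.
have scN1 (x : M) : (-1)%:A *: x = - x by rewrite !scaleN1r.
have [|G [[Glin Gker] Gmax]] := @classical_sets.Zorn_bigcup M P.
  move=> F FP Ftot; split=> [c x y [X FX Xx] [Y FY Yy] | x [X FX Xx]].
    have [XY|YX] := Ftot X Y FX FY.
      by exists Y => //; apply: (proj1 (FP _ FY)) => //; apply: XY.
    by exists X => //; apply: (proj1 (FP _ FX)) => //; apply: YX.
  exact: (proj2 (FP _ FX)).
(* The empty set is closed as well, so [0] has to be put in by maximality. *)
have G0 : G 0.
  apply: boolp.contrapT => nG0.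
  have noG x : ~ G x.
    by move=> Gx; apply: nG0; have := Glin (-1) x x Gx Gx; rewrite scN1 addNr.
  apply: (Gmax (fun x => x = 0)).
    by split=> [x Gx|/(_ 0 erefl)] //; have := noG x.
  by split=> [c x y -> ->|//]; rewrite scaler0 addr0.
have Gsurj y : exists x, G x /\ g x = y.
  apply: boolp.contrapT => noy.
  have [m gm] := gsurj y.
  pose G' x := exists c : k, exists2 u, G u & x = u + c%:A *: m.
  (* [G'] is the span of [G] and [m]. *)
  apply: (Gmax G').
    split=> [x Gx|GG']; first by exists 0, x; rewrite // !scale0r addr0.
    apply: noy; exists m; split=> //; apply: GG'.
    by exists 1, 0; rewrite // sc1 add0r.
  split=> [c x x' [d [u Gu ->]] [d' [u' Gu' ->]] | x [d [u Gu ->]]].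
    exists (c * d + d'), (c%:A *: u + u'); first exact: Glin.
    by rewrite scalerDr scaleAA addrACA scD.
  have [-> |d0] := eqVneq d 0.
    by rewrite !scale0r addr0; apply: Gker.
  rewrite linearD linearZ /= gm => /eqP; rewrite addrC addr_eq0 => /eqP dy.
  (* [u + d m] in the kernel with [d] invertible exhibits [y] as an image. *)
  case: noy; exists ((- d^-1)%:A *: u + 0); split; first exact: Glin.
  rewrite addr0 linearZ /= -[g u]opprK -dy scalerN scaleAA mulNr mulVf //.
  by rewrite !scaleN1r opprK.
have [t tP] : exists t : N -> M, forall y, G (t y) /\ g (t y) = y.
  exists (fun y => projT1 (boolp.cid (Gsurj y))) => y.
  exact: (projT2 (boolp.cid (Gsurj y))).
exists t => [y|c x y]; first by have [_] := tP y.
have [Gx gx] := tP x; have [Gy gy] := tP y; have [Gz gz] := tP (c%:A *: x + y).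
apply/eqP; rewrite -subr_eq0; apply/eqP; apply: Gker.
  rewrite addrC -scN1; apply: (Glin (-1)) => //; exact: Glin.
by rewrite linearB gz linearD linearZ /= gx gy subrr.
Qed.

(** * Projective resolutions *)

Section Pullback.
Variables (R : pzRingType) (M N P : lmodType R).
Variables (g : {linear M -> N}) (h : {linear P -> N}).

Definition pullback_pred : {pred P * M} := fun z => h z.1 == g z.2.

Lemma pullback_submod : submod_closed pullback_pred.
Proof.
split=> [|a x y]; rewrite !unfold_in /=; first by rewrite !linear0.
by move=> /eqP hx /eqP hy; rewrite !linearP hx hy.
Qed.

HB.instance Definition _ := GRing.isSubmodClosed.Build R (P * M)%type
  pullback_pred (GRing.submod_closed_semi pullback_submod).

Record pullback := Pullback { pullback_val : P * M;
                              _ : pullback_val \in pullback_pred }.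
HB.instance Definition _ := [isSub for pullback_val].
HB.instance Definition _ := [Choice of pullback by <:].
HB.instance Definition _ := [SubChoice_isSubLmodule of pullback by <:].

End Pullback.

(** A map that takes its values in the image of [g] need not be onto the
    target of [g], so the lifting property is applied to the projection from
    the pullback, which is onto. *)
Lemma projective_lift (R : pzRingType) (M N P : lmodType R)
    (g : {linear M -> N}) (h : {linear P -> N}) :
  projective_module P -> (forall x, exists y, g y = h x) ->
  exists h' : {linear P -> M}, forall x, g (h' x) = h x.
Proof.
move=> projP gh.
pose p1 (z : pullback g h) := (val z).1; pose p2 (z : pullback g h) := (val z).2.
have lin1 : linear p1 by [].
have lin2 : linear p2 by [].
pose p1L : {linear pullback g h -> P} :=
  HB.pack p1 (GRing.isLinear.Build _ _ _ _ p1 lin1).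
pose p2L : {linear pullback g h -> M} :=
  HB.pack p2 (GRing.isLinear.Build _ _ _ _ p2 lin2).
have surj x : exists z, p1L z = x.
  have [y gy] := gh x.
  have zP : (x, y) \in pullback_pred g h by rewrite unfold_in /= gy.
  by exists (Pullback zP).
have [s ps] := projP _ _ p1L idfun surj.
exists (p2L \o s) => x /=; have /eqP/= := valP (s x).
by rewrite -[(val (s x)).1]/(p1L (s x)) ps.
Qed.

Section Resolutions.
Variable R : pzRingType.

(** Augmented projective resolutions, as they occur in [pdim_le]. *)
Definition is_resolution (M : lmodType R) (P : nat -> lmodType R)
    (eps : {linear P 0%N -> M}) (del : forall i, {linear P i.+1 -> P i}) :=
  [/\ forall i, projective_module (P i),
      forall y, exists x, eps x = y,
      forall x, eps x = 0 <-> exists y, del 0%N y = x &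
      forall i x, del i x = 0 <-> exists y, del i.+1 y = x].

(** Comparison of resolutions: the composite of comparison maps from [F] to a
    resolution of length [d] and back is homotopic to the identity, and it is
    zero in degree [d.+1]. *)
Lemma resolution_contraction (M : lmodType R) (d : nat)
    (F : nat -> lmodType R) (epsF : {linear F 0%N -> M})
    (delF : forall i, {linear F i.+1 -> F i}) :
  is_resolution epsF delF -> pdim_le M d ->
  exists h : {linear F d -> F d.+1},
    forall x, exists y, x + h (delF d x) = delF d.+1 y.
Proof.
move=> [projF surF ex0F exF] [P [epsP [delP [projP surP ex0P exP Pbig]]]].
(* [f] and [g] are the comparison maps in degree [n.+1], [h] the homotopy from
   degree [n]; the three equations suffice to lift them one degree up. *)
pose inv n := exists (f : {linear F n.+1 -> P n.+1})
  (g : {linear P n.+1 -> F n.+1}) (h : {linear F n -> F n.+1}),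
  [/\ forall x, delF n x = 0 -> delP n (f x) = 0,
      forall x, delP n x = 0 -> delF n (g x) = 0 &
      forall x, delF n (g (f x) - x - h (delF n x)) = 0].
have ddF n x : delF n (delF n.+1 x) = 0 by apply/exF; exists x.
have ddP n x : delP n (delP n.+1 x) = 0 by apply/exP; exists x.
have e0F x : epsF (delF 0%N x) = 0 by apply/ex0F; exists x.
have e0P x : epsP (delP 0%N x) = 0 by apply/ex0P; exists x.
have invn n : inv n.
  elim: n => [|n [f [g [h [fK gK hK]]]]].
    have [f0 f0E] := projF 0%N _ _ epsP epsF surP.
    have [g0 g0E] := projP 0%N _ _ epsF epsP surF.
    have [f fE] : exists f : {linear F 1%N -> P 1%N},
        forall x, delP 0%N (f x) = (f0 \o delF 0%N) x.
      by apply: projective_lift => // x; apply/ex0P; rewrite /= f0E e0F.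
    have [g gE] : exists g : {linear P 1%N -> F 1%N},
        forall x, delF 0%N (g x) = (g0 \o delP 0%N) x.
      by apply: projective_lift => // x; apply/ex0F; rewrite /= g0E e0P.
    have [h hE] : exists h : {linear F 0%N -> F 1%N},
        forall x, delF 0%N (h x) = ((g0 \o f0) \- idfun) x.
      apply: projective_lift => // x; apply/ex0F.
      by rewrite /= linearB g0E f0E subrr.
    exists f, g, h; split=> x; rewrite ?fE ?gE /=; try by move=> ->; rewrite linear0.
    by rewrite !linearB gE /= fE /= hE /= opprB addrA subrK subrr.
  have [f' fE] : exists f' : {linear F n.+2 -> P n.+2},
      forall x, delP n.+1 (f' x) = (f \o delF n.+1) x.
    by apply: projective_lift => // x; apply/exP; rewrite /= fK.
  have [g' gE] : exists g' : {linear P n.+2 -> F n.+2},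
      forall x, delF n.+1 (g' x) = (g \o delP n.+1) x.
    by apply: projective_lift => // x; apply/exF; rewrite /= gK.
  have [h' hE] : exists h' : {linear F n.+1 -> F n.+2},
      forall x, delF n.+1 (h' x) = ((g \o f) \- idfun \- (h \o delF n)) x.
    by apply: projective_lift => // x; apply/exF; rewrite /= hK.
  exists f', g', h'; split=> x; rewrite ?fE ?gE /=; try by move=> ->; rewrite linear0.
  by rewrite !linearB gE /= fE /= hE /= ddF linear0 subr0 subrr.
have [f [g [h [_ _ hK]]]] := invn d.
exists h => x; suff [y yE] : exists y, delF d.+1 y = x + h (delF d x) by exists y.
apply/exF; have := hK x; rewrite (Pbig _ _ (f x)) // linear0 sub0r.
by rewrite -opprD linearN => /eqP; rewrite oppr_eq0 => /eqP.
Qed.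

End Resolutions.

(** * Tied points *)

Section Tied.
Variables (N : nat) (alpha : 'S_N.+1).
Local Notation n := N.+1.
Implicit Types i j l : 'I_n.

(** The points of the maximal path that lie over the same vertex. *)
Definition tied i j := (i == j) || (alpha i == j).
(** The vertices are represented by the smaller point over each of them, so
    that sums over vertices become sums over [is_rep]. *)
Definition tie_rep j := if (j <= alpha j)%N then j else alpha j.
Definition is_rep i := (i <= alpha i)%N.

Hypothesis aK : involutive alpha.

Lemma tiedxx i : tied i i. Proof. by rewrite /tied eqxx. Qed.
Lemma tied_alpha i : tied i (alpha i). Proof. by rewrite /tied eqxx orbT. Qed.
Lemma tied_sym i j : tied i j = tied j i.
Proof. by rewrite /tied (inv_eq aK) eq_sym [i == alpha j]eq_sym. Qed.
Lemma tied_trans j i l : tied i j -> tied j l -> tied i l.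
Proof.
rewrite /tied => /orP[/eqP<- //|/eqP<-]; rewrite aK.
by case/orP=> ->; rewrite ?orbT.
Qed.
Lemma tied_alphal i j : tied (alpha i) j = tied i j.
Proof. by rewrite /tied aK orbC. Qed.
Lemma tied_alphar i j : tied i (alpha j) = tied i j.
Proof. by rewrite tied_sym tied_alphal tied_sym. Qed.
Lemma tied_congr l i j : tied i j -> tied i l = tied j l.
Proof.
by move=> ij; apply/idP/idP; apply: tied_trans; rewrite // tied_sym.
Qed.

Lemma tie_rep_tied j : tied (tie_rep j) j.
Proof. by rewrite /tie_rep; case: ifP => _; rewrite ?tied_alphal tiedxx. Qed.

Lemma tie_rep_is_rep j : is_rep (tie_rep j).
Proof.
by rewrite /is_rep /tie_rep; case: ifPn => //; rewrite -ltnNge aK => /ltnW.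
Qed.

Lemma is_rep_unique i j : is_rep i -> tied i j -> i = tie_rep j.
Proof.
rewrite /is_rep /tie_rep /tied => ri /orP[/eqP ij|/eqP ij]; rewrite -ij ?ri // aK.
by case: leqP => // ia; apply/val_inj/anti_leq; rewrite ri ia.
Qed.

Lemma sum_rep (V : zmodType) (F : 'I_n -> V) j :
  (forall i, ~~ tied i j -> F i = 0) -> \sum_(i | is_rep i) F i = F (tie_rep j).
Proof.
move=> F0; rewrite (bigD1 (tie_rep j)) ?tie_rep_is_rep //= big1 ?addr0 // => i /andP[ri ni].
by apply: F0; apply: contra ni => /(is_rep_unique ri)->.
Qed.

End Tied.

Arguments tied_sym {N alpha} aK i j.
Arguments tied_trans {N alpha} aK {j i l}.
Arguments tied_alphal {N alpha} aK i j.
Arguments tied_alphar {N alpha} aK i j.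
Arguments tied_congr {N alpha} aK l {i j}.
Arguments tie_rep_tied {N alpha} aK j.
Arguments sum_rep {N alpha} aK {V F} j.

(** * The algebra of an involution *)

(** [rho] identifies [A] with the upper triangular matrices whose diagonal
    entries agree at [i] and [alpha i]; [of_mx] is its inverse there, with
    unspecified values elsewhere. *)
Record triangular_model (k : fieldType) (N : nat) (alpha : 'S_N.+1) (A : algType k) :=
  TriangularModel {
    rho : A -> 'M[k]_N.+1;
    of_mx : 'M[k]_N.+1 -> A;
    alphaK : involutive alpha;
    rho_lin : linear rho;
    rho1 : rho 1 = 1%:M;
    rhoM : forall x y, rho (x * y) = rho x *m rho y;
    rho_inj : injective rho;
    rho_upper : forall x (i j : 'I_N.+1), (j < i)%N -> rho x i j = 0;
    rho_tie : forall x i, rho x (alpha i) (alpha i) = rho x i i;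
    of_mxK : forall X : 'M[k]_N.+1, (forall i j : 'I_N.+1, (j < i)%N -> X i j = 0) ->
      (forall i, X (alpha i) (alpha i) = X i i) -> rho (of_mx X) = X
  }.

Section Algebra.
Variables (k : fieldType) (N : nat) (alpha : 'S_N.+1) (A : algType k).
Local Notation n := N.+1.
Implicit Types i j l a b : 'I_n.

Variable T : triangular_model alpha A.
Local Notation tied := (tied alpha).
Local Notation is_rep := (is_rep alpha).
Local Notation tie_rep := (tie_rep alpha).
Local Notation tied_sym := (tied_sym (alphaK T)).
Local Notation tied_trans := (tied_trans (alphaK T)).
Local Notation tied_alphal := (tied_alphal (alphaK T)).
Local Notation tied_alphar := (tied_alphar (alphaK T)).
Local Notation tied_congr := (tied_congr (alphaK T)).
Local Notation tie_rep_tied := (tie_rep_tied (alphaK T)).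
Local Notation sum_rep := (sum_rep (alphaK T)).

(** The idempotent at the vertex below the point [i]. *)
Definition idem i : A := of_mx T (\matrix_(a, b) ((a == b) && tied i a)%:R).
(** The path from [i] to [j]; zero unless [i < j], so that sums may range over
    all pairs. *)
Definition munit i j : A := of_mx T ((i < j)%N%:R *: delta_mx i j).

Lemma rho_idem i a b : rho T (idem i) a b = ((a == b) && tied i a)%:R.
Proof.
rewrite of_mxK ?mxE // => [c d dc|c]; rewrite !mxE ?eqxx /= ?tied_alphar //.
by rewrite (_ : (c == d) = false) //; apply/eqP=> cd; rewrite cd ltnn in dc.
Qed.

Lemma rho_munit i j a b : rho T (munit i j) a b = [&& (i < j)%N, a == i & b == j]%:R.
Proof.
rewrite of_mxK ?mxE => [|c d dc|c]; first by case: (i < j)%N; rewrite ?mul1r ?mul0r.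
  rewrite !mxE; have [ij|] := ltnP i j; last by rewrite mul0r.
  rewrite mul1r; case: eqP => // ci; case: eqP => // dj.
  by move: dc; rewrite ci dj ltnNge ltnW.
have [ij|ij] := ltnP i j; last by rewrite !scale0r !mxE.
have dia d : ((d == i) && (d == j)) = false.
  by apply/andP=> -[/eqP-> /eqP e]; rewrite e ltnn in ij.
by rewrite !mxE !dia.
Qed.

Lemma rhoD x y : rho T (x + y) = rho T x + rho T y.
Proof. by have := rho_lin T 1 x y; rewrite !scale1r. Qed.
Lemma rho0 : rho T 0 = 0.
Proof. by have := rho_lin T (-1) 0 0; rewrite !scaleN1r !addNr. Qed.
Lemma rhoZ c x : rho T (c *: x) = c *: rho T x.
Proof. by have := rho_lin T c x 0; rewrite rho0 !addr0. Qed.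
Lemma rho_sum I (r : seq I) (P : pred I) F :
  rho T (\sum_(i <- r | P i) F i) = \sum_(i <- r | P i) rho T (F i).
Proof. by apply: (big_morph _ rhoD rho0). Qed.
Lemma rhoA c : rho T (c%:A) = c%:M.
Proof. by rewrite rhoZ rho1 scalemx1. Qed.

Lemma rhoP x y : (forall i j, rho T x i j = rho T y i j) -> x = y.
Proof. by move=> xy; apply: (@rho_inj _ _ _ _ T); apply/matrixP. Qed.

Lemma rhoZE c x i j : rho T (c *: x) i j = c * rho T x i j.
Proof. by rewrite rhoZ mxE. Qed.

Lemma munit0 i j : (j <= i)%N -> munit i j = 0.
Proof. by move=> ji; apply: rhoP => a b; rewrite rho_munit rho0 mxE ltnNge ji. Qed.

Lemma rho_idemM l x i j : rho T (idem l * x) i j = (tied l i)%:R * rho T x i j.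
Proof.
rewrite rhoM mxE (bigD1 i) //= big1 => [|a ai]; first by rewrite rho_idem eqxx addr0.
by rewrite rho_idem eq_sym (negPf ai) mul0r.
Qed.

Lemma rho_Midem l x i j : rho T (x * idem l) i j = (tied l j)%:R * rho T x i j.
Proof.
rewrite rhoM mxE (bigD1 j) //= big1 => [|a ai].
  by rewrite rho_idem eqxx addr0 mulrC.
by rewrite rho_idem (negPf ai) mulr0.
Qed.

Lemma idem_tied i j : tied i j -> idem i = idem j.
Proof.
by move=> ij; apply: rhoP => a b; rewrite !rho_idem (tied_congr _ ij).
Qed.

Lemma idemM i j : idem i * idem j = (tied i j)%:R *: idem j.
Proof.
apply: rhoP => a b; rewrite rho_idemM rhoZE !rho_idem.
have [ab|ab] := eqVneq a b; rewrite ?mulr0 //= -!natrM !mulnb.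
have [ja|_] := boolP (tied j a); last by rewrite !andbF.
by rewrite !andbT [tied i a]tied_sym -(tied_congr _ ja) tied_sym.
Qed.

Lemma idem_idem i : idem i * idem i = idem i.
Proof. by rewrite idemM tiedxx scale1r. Qed.

Lemma idem_munit l i j : idem l * munit i j = (tied l i)%:R *: munit i j.
Proof.
apply: rhoP => a b; rewrite rho_idemM rhoZE !rho_munit.
by case: (eqVneq a i) => [->|]; rewrite //= !andbF !mulr0.
Qed.

Lemma munit_idem l i j : munit i j * idem l = (tied l j)%:R *: munit i j.
Proof.
apply: rhoP => a b; rewrite rho_Midem rhoZE !rho_munit.
by case: (eqVneq b j) => [->|]; rewrite //= !andbF !mulr0.
Qed.

Lemma munitM i j l b :
  munit i j * munit l b = [&& (i < j)%N, j == l & (l < b)%N]%:R *: munit i b.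
Proof.
apply: rhoP => a c; rewrite rhoZE rhoM mxE (bigD1 j) //= big1 => [|m mj].
  rewrite addr0 !rho_munit eqxx andbT -!natrM !mulnb; congr (_%:R).
  have [ij|] := ltnP i j; rewrite //=; have [<-|] := eqVneq j l; last first.
    by rewrite /= !andbF.
  have [jb|bj] := ltnP j b; last by rewrite /= andbF.
  by rewrite (ltn_trans ij jb).
by rewrite rho_munit (negPf mj) !andbF mul0r.
Qed.

Lemma sum_idem : \sum_(i | is_rep i) idem i = 1.
Proof.
apply: rhoP => a b; rewrite rho_sum rho1 summxE (sum_rep a) => [|i /negPf ia].
  by rewrite rho_idem tie_rep_tied andbT mxE.
by rewrite rho_idem ia andbF.
Qed.

Lemma rho_expand x :
  x = \sum_(i | is_rep i) rho T x i i *: idem i + \sum_i \sum_j rho T x i j *: munit i j.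
Proof.
apply: rhoP => a b; rewrite rhoD !rho_sum mxE !summxE.
rewrite (sum_rep a) => [|i /negPf ia]; last by rewrite rhoZE rho_idem ia andbF mulr0.
rewrite rhoZE rho_idem tie_rep_tied andbT (bigD1 a) //=.
rewrite [X in _ + (_ + X)]big1 => [|i ia]; last first.
  by rewrite rho_sum summxE big1 // => j _; rewrite rhoZE rho_munit eq_sym (negPf ia) andbF mulr0.
rewrite addr0 rho_sum summxE (bigD1 b) //= big1 => [|j jb]; last first.
  by rewrite rhoZE rho_munit [b == j]eq_sym (negPf jb) !andbF mulr0.
rewrite rhoZE rho_munit !eqxx addr0 !andbT.
have -> : rho T x (tie_rep a) (tie_rep a) = rho T x a a.
  by rewrite /tie_rep; case: ifP => // _; rewrite rho_tie.
have [ab|ba|/val_inj ab] := ltngtP a b.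
- by rewrite mulr1 -val_eqE /= (ltn_eqF ab) mulr0 add0r.
- by rewrite (rho_upper _ _ ba) !mul0r -val_eqE /= (gtn_eqF ba) mulr0 addr0.
- by rewrite -ab eqxx mulr1 mulr0 addr0.
Qed.

(** * Induced modules *)

(** A module over the semisimple subalgebra spanned by the [idem i], not
    necessarily unital: [proj i] is the action of [idem i].  The modules that
    occur are built from [A]-modules, so [V] is taken to be one, although only
    the scalars of [A] act compatibly with the [proj i]. *)
Record vertex_module (V : lmodType A) := VertexModule {
  proj : 'I_n -> V -> V;
  projD : forall i, {morph proj i : x y / x + y};
  projZ : forall i (c : k) w, proj i (c%:A *: w) = c%:A *: proj i w;
  projM : forall i j w, proj i (proj j w) = if tied i j then proj j w else 0;
  proj_tied : forall i j w, tied i j -> proj i w = proj j w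
}.

End Algebra.

Arguments munit {k N alpha A} T i j.
Arguments idem {k N alpha A} T i.

Section Induced.
Variables (k : fieldType) (N : nat) (alpha : 'S_N.+1) (A : algType k).
Variable T : triangular_model alpha A.
Local Notation n := N.+1.
Implicit Types i j l a b : 'I_n.
Local Notation tied := (tied alpha).
Local Notation is_rep := (is_rep alpha).
Local Notation tie_rep := (tie_rep alpha).
Local Notation idem := (idem T).
Local Notation munit := (munit T).
Local Notation rho := (rho T).
Local Notation vertex_module := (vertex_module alpha).
Local Notation tied_sym := (tied_sym (alphaK T)).
Local Notation tied_trans := (tied_trans (alphaK T)).
Local Notation tied_alphal := (tied_alphal (alphaK T)).
Local Notation tied_alphar := (tied_alphar (alphaK T)).
Local Notation tied_congr := (tied_congr (alphaK T)).
Local Notation tie_rep_tied := (tie_rep_tied (alphaK T)).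

Definition ind_pred (V : lmodType A) (e : vertex_module V) : {pred 'M[V]_n} := fun f =>
  [&& [forall i : 'I_n, forall j : 'I_n, (j < i)%N ==> (f i j == 0)],
      [forall i, forall j, proj e j (f i j) == f i j] &
      [forall i, f (alpha i) (alpha i) == f i i]].

Section Def.
Variables (V : lmodType A) (e : vertex_module V).

Lemma proj0 i : proj e i 0 = 0.
Proof. by have := projZ e i 0 0; rewrite !scale0r. Qed.

Lemma projN i w : proj e i (- w) = - proj e i w.
Proof. by apply/eqP; rewrite -addr_eq0 -projD addNr proj0. Qed.

Lemma proj_sum i I (r : seq I) (P : pred I) F :
  proj e i (\sum_(j <- r | P j) F j) = \sum_(j <- r | P j) proj e i (F j).
Proof. by apply: (big_morph _ (projD e i) (proj0 i)). Qed.

Lemma ind_predP (f : 'M[V]_n) :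
  reflect [/\ forall i j : 'I_n, (j < i)%N -> f i j = 0,
              forall i j, proj e j (f i j) = f i j &
              forall i, f (alpha i) (alpha i) = f i i] (f \in ind_pred e).
Proof.
apply: (iffP and3P) => -[H1 H2 H3]; split.
- by move=> i j ji; have /forallP/(_ i)/forallP/(_ j)/implyP/(_ ji)/eqP := H1.
- by move=> i j; have /forallP/(_ i)/forallP/(_ j)/eqP := H2.
- by move=> i; have /forallP/(_ i)/eqP := H3.
- by apply/forallP => i; apply/forallP => j; apply/implyP => ji; rewrite H1.
- by apply/forallP => i; apply/forallP => j; rewrite H2.
- by apply/forallP => i; rewrite H3.
Qed.

Lemma ind_pred_zmod : zmod_closed (ind_pred e).
Proof.
split=> [|f g /ind_predP[f1 f2 f3] /ind_predP[g1 g2 g3]]; apply/ind_predP.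
  by split=> *; rewrite !mxE ?proj0.
split=> [i j ji|i j|i]; rewrite !mxE ?projD ?projN.
- by rewrite f1 ?g1 ?subrr.
- by rewrite f2 g2.
- by rewrite f3 g3.
Qed.

HB.instance Definition _ := GRing.isZmodClosed.Build 'M[V]_n (ind_pred e) ind_pred_zmod.

End Def.

(** The induced module [A (x) V] over the semisimple subalgebra.  The entry
    [(i, j)] is the coefficient in [proj j V] of the path from [i] to [j], and
    the diagonal entries are the coefficients of the idempotents, hence equal at
    tied points.  [A] acts by matrix multiplication on the row index. *)
Record ind (S : triangular_model alpha A) (V : lmodType A) (e : vertex_module V) :=
  Ind { ind_val : 'M[V]_n; _ : ind_val \in ind_pred e }.

Section Module.
Variables (V : lmodType A) (e : vertex_module V).
Local Notation I := (ind T e).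

HB.instance Definition _ := [isSub of I for @ind_val T V e].
HB.instance Definition _ := [Choice of I by <:].
HB.instance Definition _ := [SubChoice_isSubZmodule of I by <:].

Definition ent (f : I) i j : V := val f i j.

Lemma entP (f g : I) : (forall i j, ent f i j = ent g i j) -> f = g.
Proof. by move=> fg; apply: val_inj; apply/matrixP. Qed.

Lemma ent_upper (f : I) i j : (j < i)%N -> ent f i j = 0.
Proof. by have /ind_predP[H _ _] := valP f; apply: H. Qed.
Lemma ent_proj (f : I) i j : proj e j (ent f i j) = ent f i j.
Proof. by have /ind_predP[_ H _] := valP f; apply: H. Qed.
Lemma ent_tie (f : I) i j : tied i j -> ent f i i = ent f j j.
Proof.
have /ind_predP[_ _ H] := valP f.
by case/orP=> /eqP<- //; rewrite /ent H.
Qed.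
Lemma entD (f g : I) i j : ent (f + g) i j = ent f i j + ent g i j.
Proof. by rewrite /ent /= mxE. Qed.
Lemma ent0 i j : ent 0 i j = 0.
Proof. by rewrite /ent /= mxE. Qed.
Lemma ent_sum J (r : seq J) (P : pred J) F i j :
  ent (\sum_(x <- r | P x) F x) i j = \sum_(x <- r | P x) ent (F x) i j.
Proof. by apply: (big_morph (fun f => ent f i j)) => [f g|]; rewrite (entD, ent0). Qed.

Definition ind_scale_mx (x : A) (f : I) : 'M[V]_n :=
  \matrix_(i, j) \sum_l (rho x i l)%:A *: ent f l j.

Lemma ind_scale_subproof x f : ind_scale_mx x f \in ind_pred e.
Proof.
apply/ind_predP; split=> [i j ji|i j|i]; rewrite ?mxE.
- rewrite big1 // => l _; have [jl|lj] := ltnP j l.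
    by rewrite ent_upper ?scaler0.
  by rewrite rho_upper ?scale0r ?scale0r // (leq_ltn_trans lj ji).
- by rewrite proj_sum; apply: eq_bigr => l _; rewrite projZ ent_proj.
(* Both factors are upper triangular, so one term is left on the diagonal. *)
have diag a : \sum_l (rho x a l)%:A *: ent f l a = (rho x a a)%:A *: ent f a a.
  rewrite (bigD1 a) //= big1 ?addr0 // => l la; have [al|la'] := ltnP a l.
    by rewrite ent_upper ?scaler0.
  by rewrite rho_upper ?scale0r ?scale0r // ltn_neqAle la' andbT; apply: la.
by rewrite !diag rho_tie (ent_tie f (tied_alpha alpha i)).
Qed.

Definition ind_scale x f : I := Ind T (ind_scale_subproof x f).

Lemma ent_ind_scale x f i j :
  ent (ind_scale x f) i j = \sum_l (rho x i l)%:A *: ent f l j.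
Proof. by rewrite /ent /= mxE. Qed.

Lemma ind_scaleA x y f : ind_scale x (ind_scale y f) = ind_scale (x * y) f.
Proof.
apply: entP => i j; rewrite !ent_ind_scale.
under eq_bigr => l _ do rewrite ent_ind_scale scaler_sumr.
rewrite exchange_big /=; apply: eq_bigr => m _.
rewrite rhoM mxE scaler_suml scaler_suml; apply: eq_bigr => l _.
exact: scaleAA.
Qed.

Lemma ind_scale1 : left_id 1 ind_scale.
Proof.
move=> f; apply: entP => i j; rewrite ent_ind_scale (bigD1 i) //= big1 => [|l li].
  by rewrite rho1 mxE eqxx addr0 !scale1r.
by rewrite rho1 mxE eq_sym (negPf li) !scale0r.
Qed.

Lemma ind_scaleDr : right_distributive ind_scale +%R.
Proof.
move=> x f g; apply: entP => i j; rewrite entD !ent_ind_scale -big_split.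
by apply: eq_bigr => l _; rewrite entD scalerDr.
Qed.

Lemma ind_scaleDl f : {morph ind_scale^~ f : x y / x + y}.
Proof.
move=> x y; apply: entP => i j; rewrite entD !ent_ind_scale -big_split.
by apply: eq_bigr => l _; rewrite rhoD mxE !scalerDl.
Qed.

HB.instance Definition _ := GRing.Zmodule_isLmodule.Build A I
  ind_scaleA ind_scale1 ind_scaleDr ind_scaleDl.

Lemma entZ x (f : I) i j : ent (x *: f) i j = \sum_l (rho x i l)%:A *: ent f l j.
Proof. exact: ent_ind_scale. Qed.

Lemma entZA (c : k) (f : I) i j : ent (c%:A *: f) i j = c%:A *: ent f i j.
Proof.
rewrite entZ rhoA (bigD1 i) //= big1 ?addr0 => [|l li].
  by rewrite mxE eqxx.
by rewrite mxE eq_sym (negPf li) !scale0r.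
Qed.

Lemma ent_idem l (f : I) i j : ent (idem l *: f) i j = if tied l i then ent f i j else 0.
Proof.
rewrite entZ (bigD1 i) //= big1 ?addr0 => [|m mi].
  by rewrite rho_idem eqxx scale_boolA.
by rewrite rho_idem eq_sym (negPf mi) !scale0r.
Qed.

Lemma ent_munit a b (f : I) i j :
  ent (munit a b *: f) i j = if (a < b)%N && (i == a) then ent f b j else 0.
Proof.
rewrite entZ (bigD1 b) //= big1 ?addr0 => [|m mb].
  by rewrite rho_munit eqxx andbT scale_boolA.
by rewrite rho_munit (negPf mb) !andbF !scale0r.
Qed.

(** The element [1 (x) w]. *)
Definition gen_mx (w : V) : 'M[V]_n :=
  \matrix_(i, j) if i == j then proj e i w else 0.

Lemma gen_subproof w : gen_mx w \in ind_pred e.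
Proof.
apply/ind_predP; split=> [i j ji|i j|i]; rewrite !mxE ?eqxx.
- by case: eqP => // ij; rewrite ij ltnn in ji.
- by case: eqP => [->|]; rewrite ?proj0 // projM tiedxx.
- by apply: proj_tied; rewrite tied_alphal tiedxx.
Qed.

Definition gen w : I := Ind T (gen_subproof w).

Lemma ent_gen w i j : ent (gen w) i j = if i == j then proj e i w else 0.
Proof. by rewrite /ent /= mxE. Qed.

Lemma genD : {morph gen : x y / x + y}.
Proof.
move=> x y; apply: entP => i j; rewrite entD !ent_gen.
by case: eqP; rewrite ?addr0 ?projD.
Qed.

Lemma genZ (c : k) w : gen (c%:A *: w) = c%:A *: gen w.
Proof.
apply: entP => i j; rewrite entZA !ent_gen.
by case: eqP; rewrite ?scaler0 ?projZ.
Qed.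

Lemma gen_proj j w : gen (proj e j w) = idem j *: gen w.
Proof.
apply: entP => a b; rewrite ent_idem !ent_gen; case: eqP => _; last by case: ifP.
rewrite projM tied_sym.
by case: ifP => // /(proj_tied e w).
Qed.

End Module.

(** Linear maps out of [A (x) V] are the maps out of [V] compatible with the
    idempotents. *)
Section UniversalProperty.
Variables (V : lmodType A) (e : vertex_module V) (W : lmodType A) (phi : V -> W).
Hypothesis phiD : {morph phi : x y / x + y}.
Hypothesis phiZ : forall (c : k) w, phi (c%:A *: w) = c%:A *: phi w.
Hypothesis phi_proj : forall j w, phi (proj e j w) = idem j *: phi w.
Local Notation I := (ind T e).

Definition ind_hom_fun (f : I) : W :=
  \sum_(i | is_rep i) phi (ent f i i) + \sum_i \sum_j munit i j *: phi (ent f i j).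

Let phi0 : phi 0 = 0. Proof. by have := phiZ 0 0; rewrite !scale0r. Qed.

Lemma ind_hom_additive : {morph ind_hom_fun : f g / f + g}.
Proof.
move=> f g; rewrite /ind_hom_fun addrACA -!big_split /=.
congr (_ + _); apply: eq_bigr => i _; first by rewrite entD phiD.
by rewrite -big_split /=; apply: eq_bigr => j _; rewrite entD phiD scalerDr.
Qed.

Lemma ind_hom_scalar (c : k) f : ind_hom_fun (c%:A *: f) = c%:A *: ind_hom_fun f.
Proof.
rewrite /ind_hom_fun scalerDr !scaler_sumr.
congr (_ + _); apply: eq_bigr => i _; first by rewrite entZA phiZ.
by rewrite scaler_sumr; apply: eq_bigr => j _; rewrite entZA phiZ scaleAC.
Qed.

Lemma idem_phi_ent l (f : I) i j :
  idem l *: phi (ent f i j) = if tied l j then phi (ent f i j) else 0.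
Proof.
rewrite -phi_proj -{1}[ent f i j]ent_proj projM ent_proj.
by case: ifP => // _; rewrite phi0.
Qed.

Lemma ind_hom_idem l f : ind_hom_fun (idem l *: f) = idem l *: ind_hom_fun f.
Proof.
rewrite /ind_hom_fun scalerDr !scaler_sumr.
congr (_ + _); apply: eq_bigr => i _.
  by rewrite idem_phi_ent ent_idem; case: ifP => _; rewrite ?phi0.
rewrite scaler_sumr; apply: eq_bigr => j _.
rewrite ent_idem [in RHS]scalerA idem_munit; case: ifP => _; first by rewrite scale1r.
by rewrite phi0 scaler0 !scale0r.
Qed.

Lemma ind_hom_munit a b f : ind_hom_fun (munit a b *: f) = munit a b *: ind_hom_fun f.
Proof.
have [ab|ba] := ltnP a b; last first.
  rewrite munit0 // !scale0r /ind_hom_fun big1 => [|i _]; last by rewrite ent0 phi0.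
  rewrite add0r big1 // => i _; rewrite big1 // => j _.
  by rewrite ent0 phi0 scaler0.
rewrite /ind_hom_fun scalerDr !scaler_sumr big1 => [|i _]; last first.
  rewrite ent_munit ab; case: eqP => [->|]; last by rewrite phi0.
  by rewrite ent_upper ?phi0.
rewrite add0r (bigD1 a) //= [X in _ + X]big1 ?addr0 => [|i ia]; last first.
  by rewrite big1 // => j _; rewrite ent_munit (negPf ia) andbF phi0 scaler0.
rewrite (sum_rep (alphaK T) b) => [|i /negPf ib]; last first.
  by rewrite -ent_proj phi_proj scalerA munit_idem ib !scale0r.
rewrite (ent_tie f (tie_rep_tied b)).
rewrite [in RHS](bigD1 b) //= [X in _ + (_ + X)]big1 ?addr0 => [|i ib]; last first.
  rewrite scaler_sumr big1 // => j _.
  by rewrite scalerA munitM [b == i]eq_sym (negPf ib) andbF !scale0r.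
rewrite (bigD1 b) //= ent_munit ab eqxx scaler_sumr; congr (_ + _).
rewrite [RHS](bigD1 b) //= scalerA munitM ltnn !andbF !scale0r add0r.
apply: eq_bigr => j jb; rewrite ent_munit ab eqxx scalerA munitM ab eqxx /=.
have [bj|] := ltnP b j; first by rewrite scale1r.
rewrite leq_eqVlt => /orP[/eqP/val_inj jb'|jb']; first by rewrite jb' eqxx in jb.
by rewrite ent_upper // phi0 scaler0 !scale0r.
Qed.

Lemma ind_hom_linear : linear ind_hom_fun.
Proof.
move=> x f g; rewrite ind_hom_additive; congr (_ + _); move: {g} f.
have hs J (r : seq J) (P : pred J) F : ind_hom_fun (\sum_(j <- r | P j) F j) =
    \sum_(j <- r | P j) ind_hom_fun (F j).
  apply: (big_morph _ ind_hom_additive).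
  by have := ind_hom_scalar 0 0; rewrite !scale0r.
move=> f; rewrite (rho_expand T x) !scalerDl !scaler_suml ind_hom_additive !hs.
congr (_ + _); apply: eq_bigr => i _.
  by rewrite scale_scaleA [in RHS]scale_scaleA ind_hom_scalar ind_hom_idem.
rewrite !scaler_suml hs; apply: eq_bigr => j _.
by rewrite scale_scaleA [in RHS]scale_scaleA ind_hom_scalar ind_hom_munit.
Qed.

HB.instance Definition _ := GRing.isLinear.Build A I W *:%R ind_hom_fun ind_hom_linear.
Definition ind_hom : {linear I -> W} := ind_hom_fun.

Lemma ind_homE f : ind_hom f =
  \sum_(i | is_rep i) phi (ent f i i) + \sum_i \sum_j munit i j *: phi (ent f i j).
Proof. by []. Qed.

End UniversalProperty.

Lemma ind_decomp (V : lmodType A) (e : vertex_module V) (f : ind T e) :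
  f = \sum_(i | is_rep i) gen e (ent f i i) + \sum_i \sum_j munit i j *: gen e (ent f i j).
Proof.
apply: entP => a b; rewrite entD !ent_sum.
rewrite (sum_rep (alphaK T) a) => [|i ia]; last first.
  rewrite ent_gen; case: eqP => // _.
  by rewrite -ent_proj projM tied_sym (negPf ia).
rewrite (bigD1 a) //= [X in _ + (_ + X)]big1 ?addr0 => [|i ia]; last first.
  by rewrite ent_sum big1 // => j _; rewrite ent_munit [a == i]eq_sym (negPf ia) andbF.
rewrite ent_sum (bigD1 b) //= [X in _ + (_ + X)]big1 ?addr0 => [|j jb]; last first.
  by rewrite ent_munit ent_gen (negPf jb); case: ifP.
rewrite ent_munit !ent_gen !eqxx andbT ent_proj (ent_tie f (tie_rep_tied a)).
have [ab|ba|/val_inj ab] := ltngtP a b.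
- by rewrite -val_eqE /= (ltn_eqF ab) add0r.
- by rewrite -val_eqE /= (gtn_eqF ba) addr0 ent_upper.
- by rewrite -ab eqxx ent_proj addr0.
Qed.

Lemma linear_ind (V : lmodType A) (e : vertex_module V) (W : lmodType A)
    (h : {linear ind T e -> W}) f :
  h f = \sum_(i | is_rep i) h (gen e (ent f i i)) +
        \sum_i \sum_j munit i j *: h (gen e (ent f i j)).
Proof.
rewrite {1}(ind_decomp f) linearD !linear_sum; congr (_ + _).
apply: eq_bigr => i _; rewrite linear_sum; apply: eq_bigr => j _.
by rewrite linearZ.
Qed.

(** Split the surjection over the field, and average the resulting lift of the
    generators over the idempotents to make it compatible with them. *)
Lemma ind_projective (V : lmodType A) (e : vertex_module V) : projective_module (ind T e).
Proof.
move=> M W g h gsurj; have [t gt tlin] := scalar_section gsurj.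
have t0 : t 0 = 0.
  by have := tlin (-1) 0 0; rewrite scaler0 addr0 !scaleN1r addNr.
have tD x y : t (x + y) = t x + t y.
  by have := tlin 1 x y; rewrite !scale1r.
have tZ c x : t (c%:A *: x) = c%:A *: t x.
  by have := tlin c x 0; rewrite t0 !addr0.
pose phi w := \sum_(i | is_rep i) idem i *: t (h (gen e (proj e i w))).
have phiD : {morph phi : x y / x + y}.
  move=> x y; rewrite /phi -big_split; apply: eq_bigr => i _ /=.
  by rewrite projD genD linearD tD scalerDr.
have phiZ (c : k) w : phi (c%:A *: w) = c%:A *: phi w.
  rewrite /phi scaler_sumr; apply: eq_bigr => i _ /=.
  by rewrite projZ genZ linearZ tZ scaleAC.
have phi_proj j w : phi (proj e j w) = idem j *: phi w.
  rewrite /phi scaler_sumr; apply: eq_bigr => i _ /=.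
  rewrite projM scalerA idemM scale_scaleA scale_boolA tied_sym.
  case: ifP => [/(proj_tied e w)-> //|_].
  have gen0 : gen e 0 = 0.
    by have := genZ e 0 0; rewrite !scale0r.
  by rewrite gen0 linear0 t0 scaler0.
exists (ind_hom phiD phiZ phi_proj) => f.
have gphi w : g (phi w) = h (gen e w).
  rewrite linear_sum -[RHS]scale1r -(sum_idem T) scaler_suml.
  apply: eq_bigr => i _; rewrite linearZ gt.
  by rewrite gen_proj linearZ /= scalerA idem_idem.
rewrite ind_homE linearD !linear_sum (linear_ind h f); congr (_ + _).
  by apply: eq_bigr => i _; rewrite gphi.
apply: eq_bigr => i _; rewrite linear_sum; apply: eq_bigr => j _.
by rewrite linearZ /= gphi.
Qed.

End Induced.

(** * The Koszul resolution *)

Section Koszul.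
Variables (k : fieldType) (N : nat) (alpha : 'S_N.+1) (A : algType k).
Variable T : triangular_model alpha A.
Local Notation n := N.+1.
Implicit Types i j l a b : 'I_n.
Local Notation tied := (tied alpha).
Local Notation is_rep := (is_rep alpha).
Local Notation tie_rep := (tie_rep alpha).
Local Notation idem := (idem T).
Local Notation munit := (munit T).
Local Notation rho := (rho T).
Local Notation vertex_module := (vertex_module alpha).
Local Notation tied_sym := (tied_sym (alphaK T)).
Local Notation tied_trans := (tied_trans (alphaK T)).
Local Notation tied_alphal := (tied_alphal (alphaK T)).
Local Notation tied_alphar := (tied_alphar (alphaK T)).
Local Notation tied_congr := (tied_congr (alphaK T)).
Local Notation nx := (@ordS n).
Local Notation pv := (@ord_pred n).

(** The point [a] also stands for the arrow from [a] to [nx a]; the last point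
    gives no arrow, and [arrow_el] is zero there.  If [sigma a] is
    neither isolated nor the last point, it is the arrow that starts where [a]
    ends and has zero product with [a]. *)
Definition sigma a := alpha (nx a).
Definition arrow_el a : A := munit a (nx a).
(** The vertex where the chain of [m.+1] arrows starting with [a] ends, and its
    last arrow. *)
Definition chain_target m a := nx (iter m sigma a).
Definition chain_arrow m a := arrow_el (iter m sigma a).

(** There is a chain of [m.+1] arrows starting with [a]. *)
Fixpoint has_chain m a := (a != ord_max) &&
  if m is m'.+1 then (alpha (sigma a) != sigma a) && has_chain m' (sigma a) else true.

Lemma has_chain_last m a : has_chain m a -> a != ord_max.
Proof. by case: m => [|m] /= /andP[]. Qed.

Lemma has_chainS m a :
  has_chain m.+1 a = [&& a != ord_max, alpha (sigma a) != sigma a & has_chain m (sigma a)].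
Proof. by []. Qed.

Lemma has_chain_pred m a : has_chain m.+1 a -> has_chain m a.
Proof.
elim: m a => [|m IHm] a; first by case/and3P=> /= ->.
rewrite has_chainS => /and3P[a1 a2 a3]; rewrite has_chainS a1 a2 /=; exact: IHm.
Qed.

Lemma val_nx a : a != ord_max -> nx a = a.+1 :> nat.
Proof.
move=> am; rewrite /= modn_small // ltn_neqAle ltn_ord andbT.
by apply: contra am => /eqP[e]; apply/eqP/val_inj.
Qed.

Lemma ltn_nx a : a != ord_max -> (a < nx a)%N.
Proof. by move=> /val_nx ->. Qed.

Lemma pv_last a : a != ord0 -> pv a != ord_max.
Proof.
apply: contra => /eqP pm; apply/eqP/val_inj.
by rewrite -[a]ord_predK pm /= modnn.
Qed.

Lemma val_pv a : a != ord0 -> (pv a).+1 = a :> nat.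
Proof. by move=> a0; rewrite -{2}[a]ord_predK val_nx // pv_last. Qed.

Lemma ltn_pv a : a != ord0 -> (pv a < a)%N.
Proof. by move/val_pv => e; rewrite -[X in (_ < X)%N]e. Qed.

Lemma ltn_neq0 i j : (i < j)%N -> j != ord0.
Proof. by case: eqP => // ->; rewrite ltn0. Qed.

Lemma leq_pv i j : (i < j)%N -> (i <= pv j)%N.
Proof. by move=> ij; rewrite -ltnS val_pv // (ltn_neq0 ij). Qed.

Lemma pv0 : pv ord0 = ord_max.
Proof. by apply: val_inj; rewrite /= modn_small. Qed.

Lemma chain_targetS m a : chain_target m.+1 a = chain_target m (sigma a).
Proof. by rewrite /chain_target iterSr. Qed.
Lemma chain_arrowS m a : chain_arrow m.+1 a = chain_arrow m (sigma a).
Proof. by rewrite /chain_arrow iterSr. Qed.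

Lemma arrow_el_max a : a = ord_max -> arrow_el a = 0.
Proof. by move=> ->; rewrite /arrow_el munit0 // /= modnn. Qed.

Lemma idem_chain_arrow m a : idem (chain_target m a) * chain_arrow m.+1 a = chain_arrow m.+1 a.
Proof.
by rewrite /chain_arrow /arrow_el idem_munit /chain_target /= tied_alphar tiedxx scale1r.
Qed.

Lemma arrow_el_mul a b : nx a != b -> arrow_el a * arrow_el b = 0.
Proof. by move=> /negPf ab; rewrite /arrow_el munitM ab andbF scale0r. Qed.

Lemma tied_nx a b : tied b (nx a) = (b == nx a) || (b == sigma a).
Proof. by rewrite /Submission.tied (inv_eq (alphaK T)). Qed.

Section Chain.
Variable M : lmodType A.

Lemma self_vmod_projM i j (w : M) :
  idem i *: (idem j *: w) = if tied i j then idem j *: w else 0.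
Proof. by rewrite scalerA idemM scale_scaleA scale_boolA. Qed.

Definition self_vmod : vertex_module M := @VertexModule _ _ _ _ _ (fun i w => idem i *: w)
  (fun i => scalerDr (idem i)) (fun i c w => scaleAC c (idem i) w) self_vmod_projM
  (fun i j w ij => congr1 (fun x => x *: w) (idem_tied T ij)).

Local Notation V := {ffun 'I_n -> M}.

(** The sum, over the chains of [m.+1] arrows, of the part of [M] at the end of
    the chain.  A chain is indexed by its first arrow, and its summand sits at
    the vertex where the chain starts. *)
Definition chain_proj m j (w : V) : V :=
  [ffun a => if tied a j && has_chain m a then idem (chain_target m a) *: w a else 0].

Lemma chain_projD m j : {morph chain_proj m j : x y / x + y}.
Proof.
move=> x y; apply/ffunP=> a; rewrite !ffunE; case: ifP => _; rewrite ?addr0 //.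
exact: scalerDr.
Qed.

Lemma chain_projZ m j (c : k) w : chain_proj m j (c%:A *: w) = c%:A *: chain_proj m j w.
Proof.
apply/ffunP=> a; rewrite !ffunE; case: ifP => _; rewrite ?scaler0 //.
exact: scaleAC.
Qed.

Lemma chain_projM m i j w :
  chain_proj m i (chain_proj m j w) = if tied i j then chain_proj m j w else 0.
Proof.
apply/ffunP=> a; rewrite !ffunE.
have -> : (if tied i j then chain_proj m j w else 0) a =
    if tied i j then chain_proj m j w a else 0 by case: ifP; rewrite ?ffunE.
rewrite ffunE; have [ai|ai] := boolP (tied a i); last first.
  rewrite /=; case: ifP => // ij; case: ifP => // /andP[aj _].
  by case/negP: ai; apply: tied_trans aj _; rewrite tied_sym.
rewrite -(tied_congr j ai) /=; case: (has_chain m a); rewrite ?andbT ?andbF ?if_same //.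
by case: ifP => _; rewrite ?scaler0 // self_vmod_projM tiedxx.
Qed.

Lemma chain_proj_tied m i j w : tied i j -> chain_proj m i w = chain_proj m j w.
Proof.
move=> ij; apply/ffunP=> a; rewrite !ffunE.
by rewrite ![tied a _]tied_sym (tied_congr a ij).
Qed.

Definition chain_vmod m : vertex_module V := @VertexModule _ _ _ _ _ (chain_proj m)
  (chain_projD m) (chain_projZ m) (chain_projM m) (@chain_proj_tied m).

Local Notation B := (ind T self_vmod).
Local Notation C m := (ind T (chain_vmod m)).

Lemma entC m (f : C m) i j a : ent f i j a =
  if tied a j && has_chain m a then idem (chain_target m a) *: ent f i j a else 0.
Proof. by rewrite -{1}ent_proj ffunE. Qed.

Lemma entC_tied m (f : C m) i j a : ~~ tied a j -> ent f i j a = 0.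
Proof. by rewrite entC => /negPf->. Qed.
Lemma entC_chain m (f : C m) i j a : ~~ has_chain m a -> ent f i j a = 0.
Proof. by rewrite entC => /negPf->; rewrite andbF. Qed.
Lemma entC_idem m (f : C m) i j a : idem (chain_target m a) *: ent f i j a = ent f i j a.
Proof.
rewrite entC; case: ifP => _; rewrite ?scaler0 //.
by rewrite self_vmod_projM tiedxx.
Qed.
Lemma entC_upper m (f : C m) i j a : (j < i)%N -> ent f i j a = 0.
Proof. by move=> ji; rewrite ent_upper // ffunE. Qed.
(** For [j = ord0] the predecessor is the last point, where no chain starts; so
    the formulas for the differentials need no case distinction at [ord0]. *)
Lemma entC_pv m (f : C m) i j a : (j <= i)%N -> ent f i (pv j) (pv j) = 0.
Proof.
move=> ji; have [->|j0] := eqVneq j ord0.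
  by rewrite entC_chain // pv0; apply/negP => /has_chain_last; rewrite eqxx.
by rewrite entC_upper // (leq_trans (ltn_pv j0)).
Qed.

Lemma indC_P m (f : 'M[V]_n) :
  (forall i j a, (j < i)%N -> f i j a = 0) ->
  (forall i j a, ~~ tied a j -> f i j a = 0) ->
  (forall i j a, ~~ has_chain m a -> f i j a = 0) ->
  (forall i j a, idem (chain_target m a) *: f i j a = f i j a) ->
  (forall i a, f (alpha i) (alpha i) a = f i i a) ->
  f \in ind_pred (chain_vmod m).
Proof.
move=> f1 f2 f3 f4 f5; apply/ind_predP; split=> [i j ji|i j|i].
- by apply/ffunP=> a; rewrite f1 // ffunE.
- apply/ffunP=> a; rewrite ffunE f4.
  by case: ifP => // /negbT; rewrite negb_and => /orP[/f2->|/f3->].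
- by apply/ffunP=> a; rewrite f5.
Qed.

Lemma entC_scale m x (f : C m) i j a :
  ent (x *: f) i j a = \sum_l (rho x i l)%:A *: ent f l j a.
Proof. by rewrite entZ sum_ffunE; apply: eq_bigr => l _; rewrite ffunE. Qed.

(** ** The differentials *)

(** A chain [b c] over the path [q] is sent to the chain [c] over [q b], and to
    itself without its last arrow, which then acts on [M].  The entry at [j] and
    [a] receives the first kind from the chain starting with the last arrow
    [pv j] of the path, if that arrow has zero product with [a]. *)
Definition dif_mx m (f : C m.+1) : 'M[V]_n := \matrix_(i, j) [ffun a =>
  (if (alpha j == a) && (a != j) then ent f i (pv j) (pv j) else 0) +
  ((-1) ^+ m : k)%:A *: (chain_arrow m.+1 a *: ent f i j a)].

Lemma dif_subproof m (f : C m.+1) : dif_mx f \in ind_pred (chain_vmod m).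
Proof.
apply: indC_P => [i j a ji|i j a aj|i j a ca|i j a|i a]; rewrite !mxE !ffunE.
- by rewrite entC_pv ?(ltnW ji) // if_same entC_upper // !scaler0 addr0.
- rewrite [ent f i j a]entC_tied // !scaler0 addr0; case: ifP => // /andP[/eqP ja _].
  by rewrite -ja tied_alphal tiedxx in aj.
- rewrite [ent f i j a]entC_chain ?(contra (@has_chain_pred _ _) ca) //.
  rewrite !scaler0 addr0; case: ifP => // /andP[/eqP ja _].
  rewrite entC_chain //; apply: contra ca; rewrite has_chainS /sigma ord_predK ja.
  by case/and3P.
- rewrite scalerDr scaleAC scalerA idem_chain_arrow; congr (_ + _).
  case: ifP => [/andP[/eqP ja _]|_]; last by rewrite scaler0.
  rewrite -ja -[alpha j](congr1 alpha (ord_predK j)) -chain_targetS.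
  exact: entC_idem.
- rewrite !entC_pv // !if_same !add0r.
  by rewrite (ent_tie f (_ : tied (alpha i) i)) // tied_alphal tiedxx.
Qed.

Definition dif m (f : C m.+1) : C m := Ind T (dif_subproof f).

Lemma ent_dif m (f : C m.+1) i j a : ent (dif f) i j a =
  (if (alpha j == a) && (a != j) then ent f i (pv j) (pv j) else 0) +
  ((-1) ^+ m : k)%:A *: (chain_arrow m.+1 a *: ent f i j a).
Proof. by rewrite /ent /= mxE ffunE. Qed.

Lemma entCP m (f g : C m) : (forall i j a, ent f i j a = ent g i j a) -> f = g.
Proof. by move=> fg; apply: entP => i j; apply/ffunP. Qed.

Lemma dif_linear m : linear (@dif m).
Proof.
move=> x f g; apply: entCP => i j a; rewrite entD ffunE entC_scale !ent_dif.
rewrite !entD !ffunE !entC_scale.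
under [in RHS]eq_bigr => l _ do rewrite ent_dif scalerDr.
rewrite big_split /= addrACA scalerDr scalerDr; congr (_ + (_ + _)).
- by case: ifP => _; rewrite ?addr0 // big1 ?addr0 // => l _; rewrite scaler0.
- rewrite !scaler_sumr; apply: eq_bigr => l _.
  by rewrite scaleAC scaleAA mulrC -scaleAA.
Qed.

(** The last differential sends the arrow [a] over [q] to [q a (x) 1 - q (x) a]. *)
Definition dif0_mx (f : C 0) : 'M[M]_n := \matrix_(i, j)
  (ent f i (pv j) (pv j) - \sum_a arrow_el a *: ent f i j a).

Lemma dif0_subproof (f : C 0) : dif0_mx f \in ind_pred self_vmod.
Proof.
apply/ind_predP; split=> [i j ji|i j|i]; rewrite !mxE.
- rewrite entC_pv ?(ltnW ji) // big1 ?subrr // => a _.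
  by rewrite entC_upper ?scaler0.
- have := entC_idem f i (pv j) (pv j); rewrite {1}/chain_target /= ord_predK => evj.
  rewrite scalerDr scalerN evj; congr (_ - _).
  rewrite scaler_sumr; apply: eq_bigr => a _.
  rewrite scalerA /arrow_el idem_munit; have [ja|ja] := boolP (tied j a).
    by rewrite scale1r.
  by rewrite entC_tied ?scaler0 // tied_sym.
- rewrite !entC_pv // !sub0r; congr (- _); apply: eq_bigr => a _.
  by rewrite (ent_tie f (_ : tied (alpha i) i)) // tied_alphal tiedxx.
Qed.

Definition dif0 (f : C 0) : B := Ind T (dif0_subproof f).

Lemma ent_dif0 (f : C 0) i j :
  ent (dif0 f) i j = ent f i (pv j) (pv j) - \sum_a arrow_el a *: ent f i j a.
Proof. by rewrite /ent /= mxE. Qed.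

Lemma dif0_linear : linear dif0.
Proof.
move=> x f g; apply: entP => i j; rewrite entD entZ !ent_dif0.
under [in RHS]eq_bigr => l _ do rewrite ent_dif0 scalerBr.
rewrite big_split /= sumrN addrACA -opprD !entD ffunE entC_scale; congr (_ + _ - _).
under [X in _ = X + _]eq_bigr => l _ do rewrite scaler_sumr.
rewrite exchange_big -big_split /=; apply: eq_bigr => a _.
rewrite ffunE entC_scale scalerDr scaler_sumr; congr (_ + _).
by apply: eq_bigr => l _; rewrite scaleAC.
Qed.

HB.instance Definition _ m :=
  GRing.isLinear.Build A (C m.+1) (C m) *:%R (@dif m) (@dif_linear m).
HB.instance Definition _ := GRing.isLinear.Build A (C 0) B *:%R dif0 dif0_linear.

Definition aug : {linear B -> M} :=
  @ind_hom _ _ _ _ T M self_vmod M id (fun x y => erefl) (fun c w => erefl) (fun j w => erefl).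

Lemma augE f : aug f =
  \sum_(i | is_rep i) ent f i i + \sum_i \sum_j munit i j *: ent f i j.
Proof. exact: ind_homE. Qed.

Lemma aug_surj y : exists x, aug x = y.
Proof.
exists (gen T self_vmod y); rewrite augE [X in _ + X]big1 ?addr0 => [|i _]; last first.
  rewrite big1 // => j _; rewrite ent_gen; case: eqP => [->|_]; last exact: scaler0.
  by rewrite munit0 ?scale0r.
under eq_bigr => i _ do rewrite ent_gen eqxx /=.
by rewrite -scaler_suml sum_idem scale1r.
Qed.

Lemma sigma_pv j : sigma (pv j) = alpha j.
Proof. by rewrite /sigma ord_predK. Qed.

Lemma chain_arrow_mul m (f : C m.+1) i j a :
  chain_arrow m a *: (chain_arrow m.+1 a *: ent f i j a) = 0.
Proof.
have [ca|/entC_chain->] := boolP (has_chain m.+1 a); last by rewrite !scaler0.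
rewrite scalerA /chain_arrow arrow_el_mul ?scale0r //=.
elim: m a ca {f} => [|m IHm] a; rewrite has_chainS => /and3P[_ ca cs].
  by apply: contra ca => /eqP e; rewrite -{1}e.
by have := IHm _ cs; rewrite -!iterSr.
Qed.

(** The two mixed terms cancel by the alternating signs; the terms that move or
    apply two arrows vanish because these have zero product. *)
Lemma dif_dif m f : dif (dif f) = 0 :> C m.
Proof.
apply: entCP => i j a; rewrite ent0 ffunE ent_dif.
rewrite [ent (dif f) i j a]ent_dif scalerDr [X in _ + _ *: (_ + X)]scaleAC.
rewrite chain_arrow_mul scaler0 addr0.
case: ifP => [/andP[/eqP ja _]|_]; last by rewrite !scaler0 addr0.
rewrite ent_dif eqxx andbF add0r chain_arrowS sigma_pv ja.
by rewrite exprS mulN1r !scaleNr addNr.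
Qed.

Lemma dif0_dif f : dif0 (dif f) = 0 :> B.
Proof.
apply: entP => i j; rewrite ent0 ent_dif0 ent_dif eqxx andbF add0r.
rewrite chain_arrowS sigma_pv expr0 !scale1r; apply/eqP; rewrite subr_eq0; apply/eqP.
under eq_bigr => a _.
  rewrite ent_dif expr0 !scale1r scalerDr -[arrow_el a]/(chain_arrow 0 a).
  rewrite chain_arrow_mul addr0; over.
rewrite (bigD1 (alpha j)) //= big1 ?addr0 => [|a /negPf aj]; last first.
  by rewrite eq_sym aj scaler0.
rewrite eqxx /=; case: eqP => //= aj.
rewrite entC_chain ?scaler0 // has_chainS sigma_pv aj aj eqxx /=.
by rewrite andbF.
Qed.

(** By linearity it is enough to evaluate on generators. *)
Lemma aug_dif0 f : aug (dif0 f) = 0.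
Proof.
suff genE w : aug (dif0 (gen T (chain_vmod 0) w)) = 0.
  rewrite -[aug _]/((aug \o dif0) f) (linear_ind (aug \o dif0)) /=.
  rewrite big1 ?add0r => [|i _]; last exact: genE.
  by rewrite big1 // => i _; rewrite big1 // => j _; rewrite genE scaler0.
have E i j : ent (dif0 (gen T (chain_vmod 0) w)) i j =
    (if i == pv j then chain_proj 0 i w i else 0) -
    (if i == j then \sum_a arrow_el a *: chain_proj 0 i w a else 0).
  rewrite ent_dif0 ent_gen; congr (_ - _); first by case: eqP => [->|_]; rewrite ?ffunE.
  by rewrite ent_gen; case: eqP => // _; rewrite big1 // => a _; rewrite ffunE scaler0.
rewrite augE.
have -> : \sum_(i | is_rep i) ent (dif0 (gen T (chain_vmod 0) w)) i i =
    - \sum_a arrow_el a *: chain_proj 0 a w a.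
  under eq_bigr => i _ do rewrite E eqxx.
  rewrite big_split /= big1 ?add0r => [|i _]; last first.
    case: eqP => // ip; have [i0|/ltn_pv] := eqVneq i ord0; last by rewrite -ip ltnn.
    by rewrite ffunE (_ : i = ord_max) /= ?eqxx ?andbF ?subrr // ip i0 pv0.
  rewrite sumrN exchange_big; congr (- _); apply: eq_bigr => a _.
  rewrite (sum_rep (alphaK T) a) => [|i /negPf ia].
    by rewrite (@chain_proj_tied _ _ _ _ (tie_rep_tied (alphaK T) a)).
  by rewrite ffunE tied_sym ia scaler0.
rewrite addrC; apply/eqP; rewrite subr_eq0; apply/eqP.
apply: eq_bigr => i _; rewrite (bigD1 (nx i)) //= big1 ?addr0 => [|j ji].
  rewrite E ordSK eqxx; case: eqP => [e|_]; last by rewrite subr0.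
  by rewrite /arrow_el -e munit0 ?scale0r.
rewrite E; case: eqP => [ip|_]; first by rewrite ip ord_predK eqxx in ji.
case: eqP => [->|_]; first by rewrite munit0 ?scale0r.
by rewrite subr0 scaler0.
Qed.

(** ** Exactness *)

(** The preimages of cycles come from a contracting homotopy, which is linear
    over the field only, so that it is defined by its entries.  [spread h] is the element whose component at the path from [i]
    to [a] followed by the chain starting with [a] is [h i a], and which vanishes
    at all paths ending in another way, up to the identification of the diagonal
    entries. *)
Definition spread_mx (h : 'I_n -> 'I_n -> M) : 'M[V]_n := \matrix_(i, j) [ffun a =>
  if ((j == a) && (i <= j)%N) || ((i == j) && (j == alpha a))
  then h (if i == j then a else i) a else 0].

Lemma spread_subproof m h : (forall i a, ~~ has_chain m a -> h i a = 0) ->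
  (forall i a, idem (chain_target m a) *: h i a = h i a) ->
  spread_mx h \in ind_pred (chain_vmod m).
Proof.
move=> h1 h2; apply: indC_P => [i j a ji|i j a aj|i j a ca|i j a|i a]; rewrite !mxE !ffunE.
- rewrite leqNgt ji andbF /=; case: eqP => // ij.
  by rewrite ij ltnn in ji.
- case: ifP => //; case/orP=> /andP[/eqP-ja /eqP-ij].
    by rewrite ja tiedxx in aj.
  by rewrite ij tied_alpha in aj.
- by case: ifP => // _; apply: h1.
- by case: ifP => _; rewrite ?scaler0.
- rewrite !eqxx !leqnn !andbT /=.
  by rewrite (can_eq (alphaK T)) (inv_eq (alphaK T)) orbC.
Qed.

Definition spread m h h1 h2 : C m := Ind T (@spread_subproof m h h1 h2).

Lemma ent_spread m h h1 h2 i j a : ent (@spread m h h1 h2) i j a =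
  if ((j == a) && (i <= j)%N) || ((i == j) && (j == alpha a))
  then h (if i == j then a else i) a else 0.
Proof. by rewrite /ent /= mxE ffunE. Qed.

Lemma spread_off m h h1 h2 i j a : ~~ tied a j -> ent (@spread m h h1 h2) i j a = 0.
Proof. exact: entC_tied. Qed.

Lemma spread_on m h h1 h2 i a : (i <= a)%N -> ent (@spread m h h1 h2) i a a = h i a.
Proof. by rewrite ent_spread eqxx => -> /=; case: eqP => // ->. Qed.

Lemma spread_lt m h h1 h2 i j a : (i < j)%N -> j != a ->
  ent (@spread m h h1 h2) i j a = 0.
Proof.
move=> ij /negPf ja; rewrite ent_spread ja /=.
by case: eqP => // e; rewrite e ltnn in ij.
Qed.

(** The diagonal entry at [alpha a] is determined by the one at [a]. *)
Lemma entCP_tie m (f g : C m) :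
  (forall i a, (i <= a)%N -> ent f i a a = ent g i a a) ->
  (forall i a, alpha a != a -> (i < alpha a)%N ->
     ent f i (alpha a) a = ent g i (alpha a) a) -> f = g.
Proof.
move=> H1 H2; apply: entCP => i j a.
have [ji|ij] := ltnP j i; first by rewrite !entC_upper.
have [|aj] := boolP (tied a j); last by rewrite !entC_tied.
case/orP=> /eqP aj; first by rewrite -aj H1 // aj.
have [aa|aa] := eqVneq (alpha a) a; first by rewrite -aj aa H1 // -aa aj.
move: ij; rewrite leq_eqVlt => /orP[/eqP/val_inj->|ij].
  rewrite -aj !(ent_tie _ (_ : tied (alpha a) a)) ?tied_alphal ?tiedxx //.
  exact: H1.
by rewrite -aj H2 // aj.
Qed.

(** The homotopy moves the last arrow [b] of the path [q b] into the chain: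
    [q b (x) c (x) m] goes to [q (x) b c (x) m] if [b c] is a chain. *)
Definition shift m (f : C m) i a : M :=
  if has_chain m.+1 a then ent f i (nx a) (sigma a) else 0.

Lemma shift_chain m (f : C m) i a : ~~ has_chain m.+1 a -> shift f i a = 0.
Proof. by rewrite /shift => /negPf->. Qed.

Lemma shift_idem m (f : C m) i a : idem (chain_target m.+1 a) *: shift f i a = shift f i a.
Proof. by rewrite /shift chain_targetS; case: ifP; rewrite ?scaler0 // entC_idem. Qed.

Definition homotopy m (f : C m) : C m.+1 := spread (shift_chain f) (shift_idem f).

Lemma shiftE m (f : C m) i a : alpha (sigma a) != sigma a -> a != ord_max ->
  shift f i a = ent f i (nx a) (sigma a).
Proof.
rewrite /shift has_chainS => -> -> /=.
by case: ifP => // /negbT cs; rewrite entC_chain.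
Qed.

(** At paths that end with an arrow prolonging the chain the identity holds for
    every [f]; the hypothesis covers the paths that the first
    arrow of the chain continues. *)
Lemma dif_homotopy m (f : C m) :
  (forall i a, (i <= a)%N -> ((-1) ^+ m : k)%:A *: (chain_arrow m.+1 a *: shift f i a) =
                             ent f i a a) -> dif (homotopy f) = f.
Proof.
move=> H; apply: entCP_tie => i a ia; last first.
  move=> ii; rewrite ent_dif (alphaK T) eqxx eq_sym ia /=.
  rewrite [ent (homotopy f) i (alpha a) a]spread_lt // !scaler0 addr0.
  rewrite spread_on ?leq_pv // shiftE ?pv_last ?(ltn_neq0 ii) //.
    by rewrite sigma_pv ord_predK (alphaK T).
  by rewrite sigma_pv !(alphaK T).
rewrite ent_dif eqxx andbF add0r spread_on //; exact: H.
Qed.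

(** The entry of [dif f] at [nx a] and [sigma a] gives the missing identity. *)
Lemma dif_exact m (f : C m.+1) : dif f = 0 -> exists y : C m.+2, dif y = f.
Proof.
move=> df0; exists (homotopy f); apply: dif_homotopy => i a ia.
have [ca|ca] := boolP (has_chain m.+1 a); last first.
  by rewrite shift_chain ?(contra (@has_chain_pred _ _) ca) // !scaler0 entC_chain.
move: (ca); rewrite has_chainS => /and3P[al sa _]; rewrite shiftE //.
have sn : sigma a != nx a by apply: contra sa => /eqP e; rewrite {1}e.
have := congr1 (fun g : C m => ent g i (nx a) (sigma a)) df0.
rewrite ent_dif ent0 ffunE eqxx sn /= ordSK -chain_arrowS => /eqP.
rewrite addr_eq0 => /eqP->.
by rewrite exprS mulN1r !scaleNr.
Qed.

(** Descending induction on [a]: the equation [dif0 f = 0] writes the entry at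
    [a] through the entry at [nx a], times an arrow, and another arrow that [a]
    annihilates. *)
Lemma dif0_cycle (f : C 0) : dif0 f = 0 -> forall a i, arrow_el a *: ent f i a a = 0.
Proof.
move=> df0 a; move: {2}(N - a)%N (leqnn (N - a)%N) => r.
elim: r a => [|r IHr] a ar_ i.
  rewrite arrow_el_max ?scale0r //; apply/val_inj/anti_leq.
  by rewrite -ltnS ltn_ord /= -subn_eq0 -leqn0.
have [->|al] := eqVneq a ord_max; first by rewrite arrow_el_max // scale0r.
have := congr1 (fun g : B => ent g i (nx a)) df0.
rewrite ent_dif0 ent0 ordSK => /eqP; rewrite subr_eq0 => /eqP->.
rewrite scaler_sumr big1 // => b _.
have [->|nb] := eqVneq b (nx a); last by rewrite scalerA arrow_el_mul ?scale0r // eq_sym.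
rewrite IHr ?scaler0 // val_nx // subnS.
by move: ar_; case: (N - a)%N.
Qed.

Lemma dif0_exact (f : C 0) : dif0 f = 0 -> exists y : C 1, dif y = f.
Proof.
move=> df0; exists (homotopy f); apply: dif_homotopy => i a ia.
rewrite expr0 !scale1r.
have [al|al] := eqVneq a ord_max.
  by rewrite shift_chain ?entC_chain ?scaler0 //= al eqxx.
have := congr1 (fun g : B => ent g i (nx a)) df0.
rewrite ent_dif0 ent0 ordSK => /eqP; rewrite subr_eq0 => /eqP->.
have [sn|sn] := eqVneq (sigma a) (nx a).
  rewrite shift_chain; last by rewrite has_chainS sn -[alpha (nx a)]/(sigma a) sn eqxx andbF.
  rewrite scaler0 big1 // => b _; have [->|nb] := eqVneq b (nx a).
    exact: dif0_cycle.
  by rewrite entC_tied ?scaler0 // tied_nx sn orbb.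
rewrite shiftE //; last first.
  by rewrite {1}/sigma (alphaK T) eq_sym.
rewrite (bigD1 (sigma a)) //= big1 ?addr0 // => b bs.
have [->|nb] := eqVneq b (nx a); first exact: dif0_cycle.
by rewrite entC_tied ?scaler0 // tied_nx negb_or nb.
Qed.

(** The part of [aug f] that factors through the arrow [a], with [a] divided
    out. *)
Definition tail (f : B) i a : M :=
  if has_chain 0 a then ent f i (nx a) + \sum_l munit (nx a) l *: ent f i l else 0.

Lemma tail_chain f i a : ~~ has_chain 0 a -> tail f i a = 0.
Proof. by rewrite /tail => /negPf->. Qed.

Lemma tail_idem f i a : idem (chain_target 0 a) *: tail f i a = tail f i a.
Proof.
rewrite /tail; case: ifP => _; last exact: scaler0.
rewrite scalerDr (ent_proj f i (nx a) : idem _ *: _ = _); congr (_ + _).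
rewrite scaler_sumr; apply: eq_bigr => l _.
by rewrite scalerA idem_munit tiedxx scale1r.
Qed.

Lemma arrow_el_tail f i a : arrow_el a *: tail f i a = \sum_l munit a l *: ent f i l.
Proof.
have [al|al] := eqVneq a ord_max.
  rewrite tail_chain ?scaler0 /= ?al ?eqxx // big1 // => l _.
  by rewrite munit0 ?scale0r // -ltnS ltn_ord.
rewrite /tail /= al /= scalerDr [RHS](bigD1 (nx a)) //=; congr (_ + _).
rewrite scaler_sumr (bigD1 (nx a)) //= munit0 // scale0r scaler0 add0r.
apply: eq_bigr => l ln; rewrite scalerA /arrow_el munitM ltn_nx // eqxx /=.
have [nl|] := ltnP (nx a) l; first by rewrite scale1r.
rewrite leq_eqVlt val_eqE (negPf ln) orFb val_nx // ltnS => la.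
by rewrite [munit a l]munit0 // scaler0.
Qed.

Lemma idem_aug (f : B) j : idem j *: aug f = ent f j j +
  \sum_(a | tied j a) \sum_l munit a l *: ent f a l.
Proof.
rewrite augE scalerDr !scaler_sumr; congr (_ + _).
  rewrite (sum_rep (alphaK T) j) => [|i /negPf ij].
    rewrite (ent_tie f (tie_rep_tied (alphaK T) j)); exact: (ent_proj f j j).
  by rewrite -(ent_proj f i i) self_vmod_projM tied_sym ij.
rewrite [RHS]big_mkcond; apply: eq_bigr => a _; rewrite scaler_sumr.
case: ifP => ja; last by rewrite big1 // => l _; rewrite scalerA idem_munit ja !scale0r.
by apply: eq_bigr => l _; rewrite scalerA idem_munit ja scale1r.
Qed.

Lemma aug_exact (f : B) : aug f = 0 -> exists y, dif0 y = f.
Proof.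
move=> f0; exists (spread (tail_chain f) (tail_idem f)).
apply: entP => i j; have [ji|ij] := ltnP j i; first by rewrite !ent_upper.
move: ij; rewrite leq_eqVlt => /orP[/eqP/val_inj->|ij]; last first.
  have j0 := ltn_neq0 ij.
  have tE : tail f i (pv j) = ent f i j + \sum_l munit j l *: ent f i l.
    by rewrite /tail /= pv_last //= ord_predK.
  rewrite ent_dif0 spread_on ?leq_pv // (bigD1 j) //= spread_on ?(ltnW ij) // tE.
  rewrite arrow_el_tail.
  rewrite [X in _ - (_ + X)]big1 ?addr0 ?addrK // => a aj.
  by rewrite spread_lt ?scaler0 // eq_sym.
rewrite ent_dif0 entC_pv // sub0r; have := idem_aug f j.
rewrite f0 scaler0 => /esym/eqP; rewrite addr_eq0 => /eqP->; congr (- _).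
rewrite [RHS]big_mkcond; apply: eq_bigr => a _; rewrite tied_sym.
case: ifP => ja; last by rewrite spread_off ?ja ?scaler0.
rewrite -arrow_el_tail; congr (_ *: _).
by rewrite -(ent_tie _ ja) spread_on.
Qed.

Definition koszul (d : nat) : lmodType A := if d is m.+1 then C m else B.

Definition koszul_dif (d : nat) : {linear koszul d.+1 -> koszul d} :=
  if d is m.+1 return {linear koszul d.+1 -> koszul d}
  then @dif m : {linear C m.+1 -> C m} else dif0 : {linear C 0 -> B}.

Lemma koszul_resolution : is_resolution (P := koszul) aug koszul_dif.
Proof.
split=> [[|m]|y|f|[|m] f] /=.
- exact: ind_projective.
- exact: ind_projective.
- exact: aug_surj.
- by split=> [/aug_exact//|[y <-]]; apply: aug_dif0.
- by split=> [/dif0_exact//|[y <-]]; apply: dif0_dif.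
- by split=> [/dif_exact//|[y <-]]; apply: dif_dif.
Qed.

End Chain.

(** * Finite global dimension and chains *)

Lemma gldim_finite_of_chains D : (forall a, ~~ has_chain D a) -> gldim_finite A.
Proof.
move=> noch; have noch' m a : (D <= m)%N -> ~~ has_chain m a.
  move=> /subnK<-; elim: (m - D)%N a => [|r IHr] a //.
  exact: contra (@has_chain_pred _ _) (IHr a).
exists D => M; exists (koszul M), (aug M), (@koszul_dif M).
have [pr su e0 ex] := koszul_resolution M.
split=> // -[//|m] Dm f; apply: entCP => i j a.
by rewrite entC_chain ?noch' // ent0 ffunE.
Qed.

(** The sum of one simple module for each point, so that every simple module
    occurs.  The parameter only fixes the action of [A]. *)
Definition top_module (S : triangular_model alpha A) := 'rV[k]_n.
Local Notation tops := (top_module T).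
HB.instance Definition _ := GRing.Zmodule.on tops.

Definition top_scale (x : A) (w : tops) : tops := \row_i (rho x i i * w 0 i).

Lemma rhoM_diag x y i : rho (x * y) i i = rho x i i * rho y i i.
Proof.
rewrite rhoM mxE (bigD1 i) //= big1 ?addr0 // => l li.
have [il|il] := ltnP i l; first by rewrite [rho y _ _]rho_upper ?mulr0.
by rewrite rho_upper ?mul0r // ltn_neqAle il andbT.
Qed.

Lemma top_scaleA x y w : top_scale x (top_scale y w) = top_scale (x * y) w.
Proof. by apply/rowP=> i; rewrite !mxE rhoM_diag mulrA. Qed.
Lemma top_scale1 : left_id 1 top_scale.
Proof. by move=> w; apply/rowP=> i; rewrite !mxE rho1 mxE eqxx mul1r. Qed.
Lemma top_scaleDr : right_distributive top_scale +%R.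
Proof. by move=> x v w; apply/rowP=> i; rewrite !mxE mulrDr. Qed.
Lemma top_scaleDl w : {morph top_scale^~ w : x y / x + y}.
Proof. by move=> x y; apply/rowP=> i; rewrite !mxE rhoD mxE mulrDl. Qed.

HB.instance Definition _ := GRing.Zmodule_isLmodule.Build A tops
  top_scaleA top_scale1 top_scaleDr top_scaleDl.

Lemma topE x (w : tops) i : (x *: w) 0 i = rho x i i * w 0 i.
Proof. by rewrite mxE. Qed.

Lemma top_munit i j (w : tops) : munit i j *: w = 0.
Proof.
apply/rowP=> l; rewrite topE rho_munit !mxE; case: (l =P i) => [->|]; last by rewrite andbF mul0r.
by case: (i =P j) => [->|]; rewrite ?ltnn ?andbF mul0r.
Qed.

(** Elements with vanishing diagonal are those of the radical, which linear maps
    preserve. *)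
Lemma ind_hom_radical (V V' : lmodType A) (e : vertex_module V) (e' : vertex_module V')
    (g : {linear ind T e -> ind T e'}) (f : ind T e) :
  (forall i, ent f i i = 0) -> forall i, ent (g f) i i = 0.
Proof.
move=> fi i; rewrite linear_ind entD ent_sum big1 ?add0r => [|j _]; last first.
  rewrite fi; have := genZ T e 0 0; rewrite !scale0r => ->.
  by rewrite linear0 ent0.
rewrite ent_sum big1 // => j _; rewrite ent_sum big1 // => l _.
rewrite ent_munit; case: ifP => // /andP[jl /eqP->]; exact: ent_upper.
Qed.

(** The radical acts by zero on the simple modules, so the resolution is
    minimal. *)
Lemma dif_top m (f : ind T (chain_vmod tops m.+1)) i : ent (dif f) i i = 0.
Proof.
apply/ffunP=> b; rewrite ent_dif entC_pv // if_same add0r top_munit scaler0.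
by rewrite ffunE.
Qed.

Lemma dif0_top (f : ind T (chain_vmod tops 0)) i : ent (dif0 f) i i = 0.
Proof. by rewrite ent_dif0 entC_pv // big1 ?subrr // => a _; apply: top_munit. Qed.

(** Otherwise the generator of the chain of [d.+1] arrows starting with [a]
    would lie in the radical, whereas its diagonal entry is nonzero. *)
Lemma chains_of_gldim_finite : gldim_finite A -> exists D, forall a, ~~ has_chain D a.
Proof.
case=> d pd; exists d => a; apply/negP => ca.
have [h hE] := resolution_contraction (koszul_resolution tops) (pd tops).
have hJ (x : ind T (chain_vmod tops d)) i :
    ent (h (koszul_dif tops d x) : ind T (chain_vmod tops d)) i i = 0.
  by case: d {pd ca hE} h x => [|d] h x; apply: (ind_hom_radical h) => {}i;
    [apply: dif0_top | apply: dif_top].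
pose w : {ffun 'I_n -> tops} := [ffun _ => \row__ 1].
have [y yE] := hE (gen T (chain_vmod tops d) w).
have := congr1 (fun f : ind T (chain_vmod tops d) => ent f a a a 0 (chain_target d a)) yE.
rewrite entD hJ addr0 [koszul_dif _ _ _]/(dif y) dif_top ent_gen eqxx.
rewrite !ffunE tiedxx ca /= topE rho_idem !eqxx tiedxx !mxE mulr1.
by move/eqP; rewrite oner_eq0.
Qed.

Lemma has_chain_iter m a r : has_chain m a -> (r < m)%N ->
  iter r.+1 sigma a != ord_max /\ alpha (iter r.+1 sigma a) != iter r.+1 sigma a.
Proof.
elim: m a r => [|m IHm] a r //; rewrite has_chainS => /and3P[_ sa cs].
case: r => [|r] rm; first by split=> //; apply: has_chain_last cs.
by rewrite iterSr; apply: IHm.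
Qed.

Lemma has_chain_stop m a : ~~ has_chain m a -> exists r,
  iter r sigma a = ord_max \/ alpha (iter r sigma a) = iter r sigma a.
Proof.
elim: m a => [|m IHm] a.
  by rewrite /= andbT negbK => /eqP am; exists 0%N; left.
rewrite has_chainS !negb_and !negbK => /or3P[/eqP am|/eqP sa|/IHm[r rP]].
- by exists 0%N; left.
- by exists 1%N; right.
- by exists r.+1; rewrite iterSr.
Qed.

(** * The two orbit conditions *)

Lemma zetaE a : zeta n a = nx a. Proof. by rewrite permE. Qed.

Lemma sigma_perm a : (zeta n * alpha)%g a = sigma a.
Proof. by rewrite permM zetaE. Qed.

Lemma gldim_finiteP : gldim_finite A <->
  forall O, O \in porbits (zeta n * alpha)%g ->
    exists2 i, i \in O & i = ord_max \/ alpha i = i.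
Proof.
set s := (zeta n * alpha)%g.
have sE r a : iter r s a = iter r sigma a.
  by apply: eq_iter => b; rewrite sigma_perm.
split=> [/chains_of_gldim_finite[D noD] O /imsetP[a _ ->]|H].
  have [r rP] := has_chain_stop (noD a); exists (iter r sigma a) => //.
  by rewrite -sE -permX mem_porbit.
apply: (@gldim_finite_of_chains n) => a; apply/negP => ca.
have [|b] := H (porbit s a); first exact: imset_f.
(* A point [b] of the orbit of [a] is reached from [a] in at least one and at
   most [n] steps, as required by [has_chain_iter]. *)
rewrite -(porbit_perm s 1) expg1 porbit_traject => /trajectP[r rP ->].
rewrite sE sigma_perm -iterSr => bb.
have [|b1 b2] := has_chain_iter (r := r) ca.
  by apply: leq_trans rP _; rewrite -[X in (_ <= X)%N]card_ord max_card.
by case: bb => e; [rewrite e eqxx in b1 | rewrite e eqxx in b2].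
Qed.

(** Conjugation by [alpha] exchanges the two products and fixes the isolated
    points, and [alpha * zeta] maps the point [alpha ord_max] to [ord0], whereas
    [zeta * alpha] maps [ord_max] to [alpha ord0]. *)
Lemma orbit_conditions_equiv :
  (forall O, O \in porbits (alpha * zeta n)%g ->
    exists2 i, i \in O & i = ord0 \/ alpha i = i) <->
  (forall O, O \in porbits (zeta n * alpha)%g ->
    exists2 i, i \in O & i = ord_max \/ alpha i = i).
Proof.
set s' := (alpha * zeta n)%g; set s := (zeta n * alpha)%g.
have nx_max : nx ord_max = ord0 by apply: val_inj; rewrite /= modnn.
have conj r a : (s ^+ r)%g (alpha a) = alpha ((s' ^+ r)%g a).
  rewrite !permX; elim: r => //= r ->.
  by rewrite sigma_perm /sigma permM zetaE.
split=> H O /imsetP[a _ ->].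
  have [|i] := H (porbit s' (alpha a)); first exact: imset_f.
  case/porbitP=> r ->; have := conj r (alpha a); rewrite (alphaK T).
  move: ((s' ^+ r)%g _) => b e [b0|bb].
    exists ord_max; last by left.
    rewrite -eq_porbit_mem -(porbit_perm s 1) expg1 sigma_perm /sigma nx_max -b0 -e.
    by rewrite porbit_perm.
  by exists b; [rewrite -bb -e mem_porbit | right].
have [|i] := H (porbit s (alpha a)); first exact: imset_f.
case/porbitP=> r ->; rewrite conj (alphaK T) => -[e|e].
  exists ((s' ^+ r.+1)%g a); first exact: mem_porbit.
  by left; rewrite expgSr permM permM e zetaE nx_max.
exists ((s' ^+ r)%g a); first exact: mem_porbit.
by right; rewrite -e.
Qed.
End Koszul.

(** * Paths and their coefficients *)

(* [pcomp] would otherwise denote the composition of partial functions. *)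
Local Notation pcomp := (@Defs.pcomp _).

Section Paths.
Variable Q : quiver.
Implicit Types (p q u w : qpath Q) (s : seq (arrow Q)).

Lemma walkP q : walk (pstart q) (parrows q).
Proof. exact: (valP q). Qed.

Lemma qpath_eq q u : pstart q = pstart u -> parrows q = parrows u -> q = u.
Proof.
move=> e1 e2; apply: val_inj.
by rewrite [LHS]surjective_pairing [RHS]surjective_pairing; congr (_, _).
Qed.

Lemma pcomp_arrows u w q : pcomp u w = Some q -> parrows q = parrows u ++ parrows w.
Proof.
have [e|/pcompN->//] := eqVneq (pend u) (pstart w).
by have [r -> er] := pcompP e; case=> <-; rewrite /parrows er.
Qed.

Definition walk_end v s1 := last v (map (@target Q) s1).

Lemma pend_walk_end q : pend q = walk_end (pstart q) (parrows q). Proof. by []. Qed.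

Lemma pcomp_cat q s1 s2 : parrows q = s1 ++ s2 -> exists u w,
  [/\ pcomp u w = Some q, parrows u = s1, parrows w = s2, pstart u = pstart q &
      pstart w = walk_end (pstart q) s1].
Proof.
move=> qs; have := walkP q; rewrite qs walk_cat => /andP[w1 w2].
pose u := QPath (w1 : walk (_, _).1 (_, _).2).
pose w := QPath (w2 : walk (_, _).1 (_, _).2).
have [r uw rE] := @pcompP _ u w erefl.
exists u, w; split=> //; rewrite uw; congr Some.
by apply: qpath_eq; rewrite /pstart /parrows rE // -/(parrows q) qs.
Qed.

End Paths.

Section Coefficients.
Variables (k : fieldType) (Q : quiver).
Local Notation kQ := (pathalg k Q).
Implicit Types (x y : kQ) (p q u w : qpath Q).

Lemma mcoeff_sumE (J : Type) (r : seq J) (P : pred J) (F : J -> kQ) q :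
  (\sum_(j <- r | P j) F j)@_q = \sum_(j <- r | P j) (F j)@_q.
Proof.
by apply: (big_morph (fun x : kQ => x@_q)) => [x y|]; rewrite (mcoeffD, mcoeff0).
Qed.

Lemma mcoeff_scale (c : k) x q : (c *: x)@_q = c * x@_q.
Proof. exact: mcoeffZ. Qed.

Lemma mcoeff_mul x y q : (x * y)@_q =
  \sum_(u <- msupp x) \sum_(w <- msupp y) x@_u * y@_w * (pcomp u w == Some q)%:R.
Proof.
rewrite -[x * y]/(pamul x y) pamul.unlock mcoeff_sumE; apply: eq_bigr => u _.
rewrite mcoeff_sumE; apply: eq_bigr => w _; rewrite mcoeff_scale; congr (_ * _).
rewrite /pbmul; case: (pcomp u w) => [r|] /=; last by rewrite mcoeff0.
by rewrite mcoeff_pbasis.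
Qed.

Lemma mcoeff_mul_neq0 x y q : (x * y)@_q != 0 ->
  exists u w, [/\ pcomp u w = Some q, x@_u != 0 & y@_w != 0].
Proof.
move=> xyq; have [/existsP [u]|] := boolP [exists u : msupp x, [exists w : msupp y,
   pcomp (val u) (val w) == Some q]].
  case/existsP=> w /eqP uw; exists (val u), (val w).
  by split=> //; rewrite mcoeff_neq0 fsvalP.
move=> no; case/negP: xyq; rewrite mcoeff_mul big_seq big1 // => u xu.
rewrite big_seq big1 // => w yw; case: eqP => uw; last by rewrite mulr0.
by case/negP: no; apply/existsP; exists [` xu]%fset; apply/existsP; exists [` yw]%fset;
   apply/eqP.
Qed.

Lemma mcoeff_expand x q : x@_q = \sum_(u <- msupp x) x@_u * (u == q)%:R.
Proof.
rewrite {1}(pbasis_expand x) mcoeff_sumE; apply: eq_bigr => u _.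
by rewrite mcoeff_scale mcoeff_pbasis.
Qed.

End Coefficients.

(** * The monomial algebra [A] *)

Lemma not_uniq_split (T : eqType) (s : seq T) : ~~ uniq s ->
  exists s1 a s2 s3, s = s1 ++ a :: s2 ++ a :: s3.
Proof.
elim: s => //= b s IHs; rewrite negb_and negbK => /orP[|/IHs[s1 [a [s2 [s3 ->]]]]].
  by case/splitPr=> s2 s3; exists [::], b, s2, s3.
by exists (b :: s1), a, s2, s3.
Qed.

Section Monomial.
Variables (k : fieldType) (Q : quiver) (I : pathalg k Q -> Prop).
Variables (A : falgType k) (pi : {linear pathalg k Q -> A}).
Hypothesis quadI : quadratic_monomial_ideal I.
Hypothesis piM : monoid_morphism pi.
Hypothesis pi_surj : forall y : A, exists x, pi x = y.
Hypothesis piI : forall x, pi x = 0 <-> I x.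
Local Notation kQ := (pathalg k Q).
Local Notation pb := (@pbasis k Q).
Implicit Types (x y : kQ) (p q u w : qpath Q) (a b : arrow Q).

Lemma pi_mul x y : pi (x * y) = pi x * pi y. Proof. by rewrite piM.2. Qed.

(** It also fails for arrows that are not composable, so a path is a sorted
    sequence for it exactly when the path is nonzero. *)
Definition nonzero_pair a b := pi (pb (parr a) * pb (parr b)) != 0.

Lemma pi_comp u w q : pcomp u w = Some q -> pi (pb q) = pi (pb u) * pi (pb w).
Proof. by move=> e; rewrite -pi_mul pbasisM /pbmul e. Qed.

Lemma pcomp_arrow a b q : parrows q = [:: a; b] -> pcomp (parr a) (parr b) = Some q.
Proof.
move=> qE; have := walkP q; rewrite qE /= => /and3P[/eqP sa /eqP sb _].
have [r -> rE] := @pcompP _ (parr a) (parr b) (esym sb).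
by congr Some; apply: qpath_eq; rewrite /pstart /parrows rE //= -/(parrows q) qE.
Qed.

Definition has_relation (R : qpath Q -> Prop) (q : qpath Q) :=
  exists2 r, R r & infix (parrows r) (parrows q).

(** The elements supported on paths with a relation form a two-sided ideal
    that contains the generators of [I]. *)
Lemma ideal_support (R : qpath Q -> Prop) x :
  ideal_generated_by (fun y => exists2 r, R r & y = pb r) x ->
  forall q, x@_q != 0 -> has_relation R q.
Proof.
move=> /(_ (fun x => forall q, x@_q != 0 -> has_relation R q)); apply.
  split=> [q|y z Hy Hz q|y z Hz]; first by rewrite mcoeff0 eqxx.
    rewrite mcoeffD; have [->|/Hy //] := eqVneq (y@_q) 0.
    by rewrite add0r => /Hz.
  split=> q /mcoeff_mul_neq0[u [w [/pcomp_arrows qE]]] => [_ /Hz|/Hz + _];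
    case=> r Rr /infixP[s1 [s2 rE]]; exists r => //; rewrite qE rE.
    by apply/infixP; exists (parrows u ++ s1), s2; rewrite -!catA.
  by apply/infixP; exists s1, (s2 ++ parrows w); rewrite -!catA.
move=> _ [r Rr ->] q; rewrite mcoeff_pbasis.
have [<- _|] := eqVneq r q; last by rewrite eqxx.
by exists r => //; apply: infix_refl.
Qed.

(** A zero product of two consecutive arrows is a factor of the path. *)
Lemma notI_sorted q : pi (pb q) != 0 -> sorted nonzero_pair (parrows q).
Proof.
move=> nq; apply/negPn/negP => ns; case/negP: nq.
have [s1 [a [b [s2 [qE gab]]]]] : exists s1 a b s2,
    parrows q = s1 ++ [:: a; b] ++ s2 /\ ~~ nonzero_pair a b.
  case: (parrows q) ns => // a s /=; elim: s a => //= b s IHs a.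
  have [gab /= /IHs[s1 [c [d [s2 [-> gcd]]]]]|gab _] := boolP (nonzero_pair a b).
    by exists (a :: s1), c, d, s2.
  by exists [::], a, b, s.
have [u [w [/pi_comp-> _ wE _ _]]] := pcomp_cat qE.
have [v [z [/pi_comp-> vE _ _ _]]] := pcomp_cat wE.
move: gab; rewrite negbK pi_mul -pi_mul pbasisM /pbmul (pcomp_arrow vE) => /eqP/= ->.
by rewrite mul0r mulr0.
Qed.

(** The ideal is spanned by paths, so every path in the support of an element of
    the ideal lies in it. *)
Lemma monomial_support x : pi x = 0 -> forall q, x@_q != 0 -> ~~ sorted nonzero_pair (parrows q).
Proof.
have [R [R2 IR]] := quadI.
move=> /piI/IR/ideal_support H q /H[r Rr rq].
apply/negP => /(infix_sorted rq).
have := R2 r Rr; rewrite /plength; case rE: (parrows r) => [|a [|b []]] //= _.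
rewrite andbT => /negP; apply; apply/eqP/piI/IR => J HJ RJ; apply: RJ; exists r => //.
by rewrite pbasisM /pbmul (pcomp_arrow rE).
Qed.

Lemma pi_neq0 q : (pi (pb q) != 0) = sorted nonzero_pair (parrows q).
Proof.
apply/idP/idP; first exact: notI_sorted.
apply: contraL => /eqP/monomial_support; apply.
by rewrite mcoeff_pbasis eqxx oner_eq0.
Qed.

(** A nonzero path using the arrow [a] twice contains a cycle at the end of [a]
    whose powers are all nonzero; they would be an infinite linearly independent
    family in [A]. *)
Lemma uniq_sorted q : sorted nonzero_pair (parrows q) -> uniq (parrows q).
Proof.
move=> sq; apply/negPn/negP => /not_uniq_split[s1 [a [s2 [s3 qE]]]].
pose l := rcons s2 a.
have lE : a :: s2 ++ a :: s3 = a :: l ++ s3 by rewrite /l cat_rcons.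
have pl : path nonzero_pair a l.
  by move: sq; rewrite qE lE => /cat_sorted2[_] /=; rewrite cat_path => /andP[].
have wl : walk (target a) l.
  by have := walkP q; rewrite qE lE walk_cat /= walk_cat => /and3P[_ _ /andP[]].
pose f m := flatten (nseq m l).
have fP m : [&& path nonzero_pair a (f m), last a (f m) == a, walk (target a) (f m) &
                last (target a) (map (@target Q) (f m)) == target a].
  elim: m => [|m /and4P[IH1 IH2 IH3 IH4]]; first by rewrite /= !eqxx.
  rewrite /f /= -/(f m) cat_path last_cat walk_cat map_cat last_cat pl wl.
  by rewrite /l last_rcons map_rcons last_rcons IH1 IH2 IH3 IH4.
have wf m : walk (target a, f m).1 (target a, f m).2 by case/and4P: (fP m).
pose c m : qpath Q := QPath (wf m).
have c_inj : injective c.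
  move=> m1 m2 /(congr1 (fun q => size (parrows q))); rewrite /parrows /= /f.
  rewrite !size_flatten /shape !map_nseq !sumn_nseq /l size_rcons.
  by move/eqP; rewrite eqn_mul2l /= => /eqP.
have c_neq0 m : sorted nonzero_pair (parrows (c m)).
  by have /and4P[pf _ _ _] := fP m; apply: path_sorted pf.
pose d := \dim {:A}.
pose X := [tuple pi (pb (c i)) | i < d.+1].
have : free X.
  apply/freeP => lam lam0 i; apply/eqP/negPn/negP => lami.
  have : pi (\sum_(j < d.+1) lam j *: pb (c j)) = 0.
    rewrite linear_sum -[RHS]lam0; apply: eq_bigr => j _.
    by rewrite linearZ -tnth_nth tnth_mktuple.
  move/monomial_support/(_ (c i)); rewrite c_neq0 mcoeff_sumE (bigD1 i) //=.
  rewrite big1 => [|j ji].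
    by rewrite addr0 mcoeff_scale mcoeff_pbasis eqxx mulr1 => /(_ lami).
  rewrite mcoeff_scale mcoeff_pbasis (inj_eq c_inj) -[(_ : nat) == _]/(j == i).
  by rewrite (negPf ji) mulr0.
rewrite /free size_tuple => /eqP dX.
by have := dimvS (subvf <<X>>); rewrite dX ltnn.
Qed.

Lemma sorted_size q : sorted nonzero_pair (parrows q) -> (plength q <= #|arrow Q|)%N.
Proof. by move/uniq_sorted/card_uniqP => e; rewrite /plength -e max_card. Qed.

(** The starting vertex is part of the definition because the arrows alone do
    not locate a trivial path. *)
Definition subpath u q := exists s1 s2,
  parrows q = s1 ++ parrows u ++ s2 /\ pstart u = walk_end (pstart q) s1.

Lemma subpath_refl q : subpath q q.
Proof. by exists [::], [::]; rewrite cats0. Qed.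

Lemma subpath_compl u w q z : pcomp u w = Some q -> subpath q z -> subpath u z.
Proof.
move=> uw [s1 [s2 [zE qE]]]; exists s1, (parrows w ++ s2).
rewrite zE (pcomp_arrows uw) -!catA; split=> //.
by rewrite -qE; have [->] := pcomp_ends uw.
Qed.

Lemma subpath_compr u w q z : pcomp u w = Some q -> subpath q z -> subpath w z.
Proof.
move=> uw [s1 [s2 [zE qE]]]; exists (s1 ++ parrows u), s2.
rewrite zE (pcomp_arrows uw) -!catA; split=> //.
have [e|/pcompN ne] := eqVneq (pend u) (pstart w); last by rewrite ne in uw.
rewrite -e /walk_end map_cat last_cat -/(walk_end (pstart z) s1) -qE.
by have [->] := pcomp_ends uw.
Qed.

Lemma extend_path q : pi (pb q) != 0 -> maximal_path I q \/
  exists z, [/\ pi (pb z) != 0, plength z = (plength q).+1 &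
                forall m, subpath z m -> subpath q m].
Proof.
move=> nq; have [/forallP mx|] := boolP [forall a,
    (pi (pb q * pb (parr a)) == 0) && (pi (pb (parr a) * pb q) == 0)].
  left; split=> [/piI/eqP|a]; first by rewrite (negPf nq).
  by have /andP[/eqP/piI ? /eqP/piI] := mx a.
rewrite negb_forall => /existsP[a]; rewrite negb_and !pbasisM /pbmul => no; right.
case/orP: no; case uw: (Defs.pcomp _ _) => [z|]; rewrite /= ?linear0 ?eqxx // => nz.
  exists z; split=> // [|m]; last exact: subpath_compl uw.
  by rewrite /plength (pcomp_arrows uw) size_cat addn1.
exists z; split=> // [|m]; last exact: subpath_compr uw.
by rewrite /plength (pcomp_arrows uw) size_cat.
Qed.

(** Nonzero paths have bounded length, so extending one as long as possible
    reaches a maximal path. *)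
Lemma subpath_maximal q : pi (pb q) != 0 -> exists2 z, maximal_path I z & subpath q z.
Proof.
move: {2}(#|arrow Q| - plength q)%N (leqnn (#|arrow Q| - plength q)%N) => r.
elim: r q => [|r IHr] q le_r nq.
all: have [mq|[z [nz zE zq]]] := extend_path nq;
       first by exists q => //; apply: subpath_refl.
all: have := nz; rewrite pi_neq0 => /sorted_size; rewrite zE => sz.
  by rewrite leqn0 subn_eq0 leqNgt sz in le_r.
have [||m mm zm] := IHr z; rewrite ?zE ?subnS //; last by exists m => //; apply: zq.
by move: le_r; case: (_ - _)%N.
Qed.

End Monomial.

(** * Coordinates along the maximal path *)

Section Coordinates.
Variables (k : fieldType) (Q : quiver) (I : pathalg k Q -> Prop).
Variables (A : falgType k) (pi : {linear pathalg k Q -> A}).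
Hypothesis quadI : quadratic_monomial_ideal I.
Hypothesis piM : monoid_morphism pi.
Hypothesis pi_surj : forall y : A, exists x, pi x = y.
Hypothesis piI : forall x, pi x = 0 <-> I x.
Local Notation kQ := (pathalg k Q).
Local Notation pb := (@pbasis k Q).
Variable p : qpath Q.
Hypothesis maxp : maximal_path I p.
Hypothesis uniqp : forall q, maximal_path I q -> q = p.
Variable alpha : 'S_(plength p).+1.
Hypothesis assoc : associated_quasi_diagram alpha.
Local Notation N := (plength p).
Local Notation n := N.+1.
Implicit Types (x y : kQ) (q u w : qpath Q) (i j l : 'I_n).
Local Notation tied := (tied alpha).

Lemma pvertE i : pvert i = walk_end (pstart p) (take i (parrows p)).
Proof.
rewrite /pvert /pverts /walk_end map_take.
have : (i <= size (map (@target Q) (parrows p)))%N by rewrite size_map -ltnS ltn_ord.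
move: (map _ _) (pstart p) (i : nat) => s v {}i.
elim: s v i => [|a s IHs] v [|i] //=; rewrite ltnS => le_is.
by rewrite -IHs //; apply: set_nth_default.
Qed.

Lemma alpha_vert i : pvert (alpha i) = pvert i.
Proof.
have [H1 H2] := assoc i.
have [/existsP[j /andP[ji /eqP e]]|no] := boolP [exists j, (j != i) && (pvert j == pvert i)].
  by rewrite (H1 j) //; apply/eqP.
rewrite H2 // => j /eqP ji e; case/negP: no; apply/existsP; exists j.
by rewrite ji e eqxx.
Qed.

Lemma tied_vert i j : (pvert i == pvert j) = tied i j.
Proof.
apply/eqP/orP => [e|[/eqP->|/eqP<-]]; rewrite ?alpha_vert //.
have [->|ij] := eqVneq i j; [by left | right].
have [H _] := assoc i; apply/eqP/H => //; apply/eqP; by rewrite eq_sym.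
Qed.

Lemma alpha_involutive : involutive alpha.
Proof.
move=> i; have [e|ne] := eqVneq (alpha i) i; first by rewrite !e.
have [H _] := assoc (alpha i); apply: H; last by rewrite alpha_vert.
by apply/eqP; rewrite eq_sym.
Qed.

Definition seg i j := take (j - i) (drop i (parrows p)).

Lemma seg_walk i j : walk (pvert i, seg i j).1 (pvert i, seg i j).2.
Proof.
rewrite /= /seg; have := walkP p.
rewrite -{1}(cat_take_drop i (parrows p)) walk_cat -/(walk_end _ _) -pvertE => /andP[_].
by rewrite -{1}(cat_take_drop (j - i) (drop i (parrows p))) walk_cat => /andP[].
Qed.

(** Meaningful for [i <= j] only; it is the trivial path at the [i]-th vertex
    otherwise. *)
Definition segment i j : qpath Q := QPath (seg_walk i j).

Lemma plength_segment i j : plength (segment i j) = (j - i)%N.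
Proof.
rewrite /plength /parrows /= /seg size_takel // size_drop leq_sub2r //.
by rewrite -ltnS ltn_ord.
Qed.

Lemma seg_cat i l j : (i <= l <= j)%N -> seg i j = seg i l ++ seg l j.
Proof.
case/andP=> il lj; rewrite /seg.
have -> : (j - i = (l - i) + (j - l))%N by rewrite addnC addnBA // subnK.
by rewrite takeD drop_drop subnK.
Qed.

Lemma pend_segment i j : (i <= j)%N -> pend (segment i j) = pvert j.
Proof.
move=> ij; rewrite pend_walk_end -[pstart _]/(pvert i) -[parrows _]/(seg i j).
by rewrite !pvertE /walk_end -[in RHS](subnKC ij) takeD map_cat last_cat.
Qed.

Lemma segment_comp i l j : (i <= l <= j)%N ->
  pcomp (segment i l) (segment l j) = Some (segment i j).
Proof.
move=> ilj; have [il _] := andP ilj.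
have [r -> rE] := @pcompP _ (segment i l) (segment l j) (pend_segment il).
by congr Some; apply: val_inj; rewrite rE /parrows /= -seg_cat.
Qed.

Lemma segment_split i j u w : (i <= j)%N -> pcomp u w = Some (segment i j) ->
  exists l, [/\ (i <= l <= j)%N, u = segment i l & w = segment l j].
Proof.
move=> ij uw; have uwE := pcomp_arrows uw.
have sz : (i + plength u <= j)%N.
  rewrite -(subnKC ij) leq_add2l -plength_segment /plength uwE size_cat.
  exact: leq_addr.
pose l : 'I_n := inord (i + plength u).
have lE : l = (i + plength u)%N :> nat.
  by rewrite inordK // (leq_ltn_trans sz).
have ilj : (i <= l <= j)%N by rewrite lE leq_addr.
have [su _] := pcomp_ends uw.
have [e|/pcompN ne] := eqVneq (pend u) (pstart w); last by rewrite ne in uw.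
have := uwE; rewrite /parrows [LHS]/= (seg_cat ilj) => /eqP.
rewrite eqseq_cat; last by rewrite -[LHS]/(plength (segment i l)) plength_segment lE addKn.
case/andP=> /eqP uE /eqP wE.
have uS : u = segment i l by apply: qpath_eq.
exists l; split=> //; apply: qpath_eq; last by rewrite /parrows -wE.
by rewrite -e uS pend_segment //; case/andP: ilj.
Qed.

Lemma segment_of_subpath q : subpath q p -> exists i j, (i <= j)%N /\ q = segment i j.
Proof.
case=> s1 [s2 [pE qs]].
have sz : (size s1 + plength q <= plength p)%N.
  by rewrite {2}/plength pE !size_cat addnA leq_addr.
pose i : 'I_n := inord (size s1); pose j : 'I_n := inord (size s1 + plength q).
have iE : i = size s1 :> nat by rewrite inordK // ltnS (leq_trans (leq_addr _ _) sz).
have jE : j = (size s1 + plength q)%N :> nat by rewrite inordK.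
exists i, j; split; first by rewrite iE jE leq_addr.
apply: qpath_eq; rewrite /pstart /parrows /=.
  by rewrite pvertE iE pE take_size_cat.
by rewrite /seg jE iE addKn pE drop_size_cat // take_size_cat.
Qed.

Lemma sorted_p : sorted (nonzero_pair pi) (parrows p).
Proof. by rewrite -(pi_neq0 quadI piM piI); apply/eqP => /piI; case: maxp. Qed.

Lemma uniq_p : uniq (parrows p).
Proof. exact: (uniq_sorted quadI piI) sorted_p. Qed.

Lemma segment_neq0 i j : pi (pb (segment i j)) != 0.
Proof. by rewrite (pi_neq0 quadI piM piI) take_sorted // drop_sorted // sorted_p. Qed.

Lemma nonzero_segment q : pi (pb q) != 0 -> exists i j, (i <= j)%N /\ q = segment i j.
Proof.
move=> /(subpath_maximal quadI piM piI)[z /uniqp->]; exact: segment_of_subpath.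
Qed.

(** The arrows of [p] are distinct, so a nontrivial segment is determined by its
    first arrow and its length. *)
Lemma segment_inj i j i' j' : (i < j)%N -> (i' < j')%N ->
  (segment i j == segment i' j') = (i == i') && (j == j').
Proof.
move=> ij ij'; apply/eqP/andP=> [e|[/eqP-> /eqP->] //].
have sj (l : 'I_n) : (l <= size (parrows p))%N by rewrite -ltnS ltn_ord.
have nthseg (a b : 'I_n) (x0 : arrow Q) : (a < b)%N ->
    nth x0 (parrows (segment a b)) 0%N = nth x0 (parrows p) a.
  by move=> ab; rewrite /parrows /= /seg nth_take ?subn_gt0 // nth_drop addn0.
have x0 : arrow Q.
  by have := plength_segment i j; rewrite /plength; case: (parrows _) => // /esym/eqP;
     rewrite subn_eq0 leqNgt ij.
have ii : i = i'.
  apply/val_inj/eqP; rewrite -(nth_uniq x0 _ _ uniq_p) ?(leq_trans ij) ?(leq_trans ij') //.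
  by rewrite -(nthseg i j) // -(nthseg i' j') // e.
split; first exact/eqP.
have ij2 : (i <= j')%N by rewrite ii (ltnW ij').
have := congr1 (@plength Q) e; rewrite !plength_segment -ii => /eqP.
by rewrite (eqn_sub2rE (ltnW ij) ij2) val_eqE.
Qed.

Lemma segment_refl i : segment i i = ptriv (pvert i).
Proof. by apply: qpath_eq; rewrite /parrows //= /seg subnn take0. Qed.

(** The diagonal entries are the coefficients of the trivial paths, which
    coincide at tied points. *)
Definition coord x : 'M[k]_n :=
  \matrix_(i, j) if (i <= j)%N then x@_(segment i j) else 0.

Lemma coord_upper x i j : (j < i)%N -> coord x i j = 0.
Proof. by move=> ji; rewrite mxE leqNgt ji. Qed.

Lemma coord_tie x i : coord x (alpha i) (alpha i) = coord x i i.
Proof. by rewrite !mxE !leqnn !segment_refl alpha_vert. Qed.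

Lemma coord_linear : linear coord.
Proof.
move=> c x y; apply/matrixP=> i j; rewrite !mxE.
by case: ifP => _; rewrite ?mulr0 ?addr0 // mcoeffD mcoeff_scale.
Qed.

Lemma coord1 : coord 1 = 1%:M.
Proof.
apply/matrixP=> i j; rewrite !mxE pathalg1E; case: leqP => ij; last first.
  by rewrite -val_eqE /= gtn_eqF.
rewrite mcoeff_sumE; have [->|ne] := eqVneq i j.
  rewrite segment_refl (bigD1 (pvert j)) //= big1 => [|v vj].
    by rewrite mcoeff_pbasis eqxx addr0.
  rewrite mcoeff_pbasis; case: eqP => // /(congr1 (@pstart Q)) e.
  by rewrite -[v]/(pstart (ptriv v)) e eqxx in vj.
rewrite big1 // => v _; rewrite mcoeff_pbasis; case: eqP => // /(congr1 (@plength Q)).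
rewrite plength_segment => /esym/eqP; rewrite subn_eq0 => ji.
by case/eqP: ne; apply/val_inj/anti_leq; rewrite ij ji.
Qed.

(** A segment factors in one way for each intermediate point; this is what makes
    [coord] multiplicative. *)
Lemma pcomp_segment_sum i j u w : (i <= j)%N ->
  (pcomp u w == Some (segment i j))%:R =
  \sum_(l : 'I_n) (if (i <= l)%N then (u == segment i l)%:R else 0) *
         (if (l <= j)%N then (w == segment l j)%:R else 0) :> k.
Proof.
move=> ij; case: eqP => [/(segment_split ij)[l [/andP[il lj] uE wE]]|no].
  rewrite (bigD1 l) //= il lj uE wE !eqxx mulr1 big1 ?addr0 // => m ml.
  case: leqP => im; last by rewrite mul0r.
  case: eqP => [/(congr1 (@plength Q))/eqP|]; last by rewrite mul0r.
  by rewrite !plength_segment eqn_sub2rE // val_eqE eq_sym (negPf ml).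
rewrite big1 // => l _; case: (leqP i l) => il; last by rewrite mul0r.
case: (leqP l j) => lj; last by rewrite mulr0.
case: eqP => [uE|_]; last by rewrite mul0r.
case: eqP => [wE|_]; last by rewrite mulr0.
by case: no; rewrite uE wE segment_comp // il lj.
Qed.

Lemma coordM x y : coord (x * y) = coord x *m coord y.
Proof.
apply/matrixP=> i j; rewrite !mxE.
under eq_bigr => l _ do rewrite !mxE.
case: ifP => ij; last first.
  rewrite big1 // => l _; case: ifP => il; last by rewrite mul0r.
  case: ifP => lj; last by rewrite mulr0.
  by rewrite (leq_trans il lj) in ij.
rewrite mcoeff_mul.
transitivity (\sum_(u <- msupp x) \sum_(w <- msupp y) \sum_(l : 'I_n) x@_u * y@_w *
    ((if (i <= l)%N then (u == segment i l)%:R else 0) *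
     (if (l <= j)%N then (w == segment l j)%:R else 0))).
  apply: eq_bigr => u _; apply: eq_bigr => w _.
  by rewrite pcomp_segment_sum // mulr_sumr.
etransitivity; first by apply: eq_bigr => u _; apply: exchange_big.
rewrite exchange_big /=; apply: eq_bigr => l _.
case: (leqP i l) => il; last first.
  by rewrite mul0r big1 // => u _; rewrite big1 // => w _; rewrite mul0r mulr0.
case: (leqP l j) => lj; last first.
  by rewrite mulr0 big1 // => u _; rewrite big1 // => w _; rewrite !mulr0.
rewrite (mcoeff_expand x) (mcoeff_expand y) mulr_suml; apply: eq_bigr => u _.
by rewrite mulr_sumr; apply: eq_bigr => w _; rewrite mulrACA.
Qed.

(** A path is zero in [A] if and only if it is not a segment. *)
Lemma coord_eq0 x : coord x = 0 <-> pi x = 0.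
Proof.
split=> [x0|x0]; last first.
  apply/matrixP=> i j; rewrite !mxE; case: ifP => // ij; apply/eqP/negPn/negP.
  by move/(monomial_support quadI piI x0)/negP; apply; rewrite -(pi_neq0 quadI piM piI) segment_neq0.
rewrite (pbasis_expand x) linear_sum big1 // => q _; rewrite linearZ /=.
have [->|/nonzero_segment[i [j [ij ->]]]] := eqVneq (pi (pb q)) 0; first exact: scaler0.
by have := congr1 (fun X : 'M[k]_n => X i j) x0; rewrite !mxE ij => ->; rewrite scale0r.
Qed.

Definition of_coord (X : 'M[k]_n) : kQ :=
  \sum_(i | is_rep alpha i) X i i *: pb (ptriv (pvert i)) +
  \sum_(i : 'I_n) \sum_(j : 'I_n) (if (i < j)%N then X i j *: pb (segment i j) else 0).

Lemma coord_of_coord (X : 'M[k]_n) : (forall i j, (j < i)%N -> X i j = 0) ->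
  (forall i, X (alpha i) (alpha i) = X i i) -> coord (of_coord X) = X.
Proof.
move=> Xup Xtie; apply/matrixP=> a b; rewrite mxE; case: leqP => ab; last by rewrite Xup.
have eV i : (ptriv (pvert i) == ptriv (pvert a)) = tied i a.
  rewrite -tied_vert; apply/eqP/eqP => [/(congr1 (@pstart Q)) //|-> //].
rewrite mcoeffD !mcoeff_sumE.
under eq_bigr => i _ do rewrite mcoeff_scale mcoeff_pbasis.
under [X in _ + X]eq_bigr => i _ do rewrite mcoeff_sumE.
move: ab; rewrite leq_eqVlt => /orP[/eqP/val_inj<-|ab].
  rewrite [X in _ + X]big1 ?addr0 => [|i _].
    rewrite (sum_rep alpha_involutive a) => [|i /negPf ia]; last first.
      by rewrite segment_refl eV ia mulr0.
    rewrite segment_refl eV (tie_rep_tied alpha_involutive) mulr1.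
    by rewrite /tie_rep; case: ifP.
  rewrite big1 // => j _; case: ifP => ij; last by rewrite mcoeff0.
  rewrite mcoeff_scale mcoeff_pbasis; case: eqP => [/(congr1 (@plength Q))/eqP|]; last by rewrite mulr0.
  by rewrite !plength_segment subnn subn_eq0 leqNgt ij.
rewrite big1 ?add0r => [|i _].
  rewrite (bigD1 a) //= [X in _ + X]big1 ?addr0 => [|i ia]; last first.
    rewrite big1 // => j _; case: ifP => ij; last by rewrite mcoeff0.
    by rewrite mcoeff_scale mcoeff_pbasis segment_inj // (negPf ia) mulr0.
  rewrite (bigD1 b) //= ab mcoeff_scale mcoeff_pbasis eqxx mulr1 big1 ?addr0 // => j jb.
  case: ifP => aj; last by rewrite mcoeff0.
  by rewrite mcoeff_scale mcoeff_pbasis segment_inj // (negPf jb) andbF mulr0.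
case: eqP => [/(congr1 (@plength Q))/esym/eqP|]; last by rewrite mulr0.
by rewrite plength_segment subn_eq0 leqNgt ab.
Qed.

Lemma pi_surjb (y : A) : exists x, pi x == y.
Proof. by have [x <-] := pi_surj y; exists x. Qed.

Definition coordA (y : A) : 'M[k]_n := coord (xchoose (pi_surjb y)).

Lemma coordA_pi x : coordA (pi x) = coord x.
Proof.
have /eqP e := xchooseP (pi_surjb (pi x)); rewrite /coordA; move: (xchoose _) e => z e.
have : coord (-1 *: z + x) = 0.
  by apply/coord_eq0; rewrite linearP e scaleN1r addNr.
by rewrite coord_linear scaleN1r addrC => /eqP; rewrite subr_eq0 => /eqP.
Qed.

Lemma coord_model : triangular_model alpha A.
Proof.
exists coordA (fun X => pi (of_coord X)).
- exact: alpha_involutive.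
- move=> c y z; have [x <-] := pi_surj y; have [x' <-] := pi_surj z.
  by rewrite -linearP !coordA_pi coord_linear.
- by rewrite -piM.1 coordA_pi coord1.
- move=> y z; have [x <-] := pi_surj y; have [x' <-] := pi_surj z.
  by rewrite -piM.2 !coordA_pi coordM.
- move=> y z; have [x <-] := pi_surj y; have [x' <-] := pi_surj z.
  rewrite !coordA_pi => e; apply/eqP; rewrite -subr_eq0 -linearB; apply/eqP/coord_eq0.
  by rewrite -scaleN1r addrC coord_linear e scaleN1r addNr.
- by move=> y i j; have [x <-] := pi_surj y; rewrite coordA_pi; apply: coord_upper.
- by move=> y i; have [x <-] := pi_surj y; rewrite coordA_pi coord_tie.
- by move=> X X1 X2; rewrite coordA_pi coord_of_coord.
Qed.

End Coordinates.

(* In mathcomp (s * t)%g x = t (s x): the right-to-left composite of zeta and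
   alpha, alpha first, is alpha * zeta. *)
Theorem theorem1p1 (k : closedFieldType) (char0 : [pchar k]%R =i pred0)
    (Q : quiver) (I : pathalg k Q -> Prop) (gentleI : locally_gentle I)
    (A : falgType k) (isoA : iso_quotient I A)
    (p : qpath Q) (maxp : maximal_path I p)
    (uniqp : forall q : qpath Q, maximal_path I q -> q = p)
    (alpha : 'S_(plength p).+1) (assoc : associated_quasi_diagram alpha) :
  [<-> gldim_finite A;
       forall O, O \in porbits (alpha * zeta (plength p).+1)%g ->
         exists2 i, i \in O & i = ord0 \/ alpha i = i;
       forall O, O \in porbits (zeta (plength p).+1 * alpha)%g ->
         exists2 i, i \in O & i = ord_max \/ alpha i = i].

Proof.
have [_ quadI _] := gentleI; have [pi [piM pi_surj piI]] := isoA.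
have T := coord_model quadI piM pi_surj piI maxp uniqp assoc.
have [H1 H2] := gldim_finiteP T; have [H3 H4] := orbit_conditions_equiv T.
by tfae => // /H1/H4.
Qed.
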